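(* Let $\mathcal H$ be a separable infinite dimensional Hilbert space, let $p\in\mathbb N$, and let $F:\mathbf D_{\mathbf q}(\mathcal H)\to B(\mathcal H)^p$ be a bounded free holomorphic function with $\|F\|_\infty\le1$. If $F(0)=0$, then $$\|F(\mathbf X)\|\le m_{\mathbf D_{\mathbf q}}(\mathbf X)<1,\qquad\mathbf X\in\mathbf D_{\mathbf q}(\mathcal H),$$ where $m_{\mathbf D_{\mathbf q}}$ is the Minkowski functional associated with the regular polydomain $\mathbf D_{\mathbf q}(\mathcal H)$. In particular, if $p=1$, the free holomorphic function $$\psi(\mathbf X):=\sum_{i=1}^k\sum_{j=1}^{n_i}\frac{\partial f}{\partial z_{i,j}}(0)X_{i,j},\qquad\mathbf X=\{X_{i,j}\}\in\mathbf D_{\mathbf q}(\mathcal H),$$ has the property that $\|\psi(\mathbf X)\|\le m_{\mathbf D_{\mathbf q}}(\mathbf X)<1$ for any $\mathbf X\in\mathbf D_{\mathbf q}(\mathcal H)$, where $f(\mathbf z):=F(\mathbf z)$, for $\mathbf z=\{z_{i,j}\}\in\mathbf D_{\mathbf q}(\mathbb C)$, is the scalar representation of $F$.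
   Context: Polydomains. Fix $k\in\mathbb N=\{1,2,\dots\}$ and $n_1,\dots,n_k\in\mathbb N$. Hilbert spaces are complex; $A>0$ means that the operator $A$ is positive and invertible. $\mathbb F_{n_i}^+$ is the unital free semigroup on generators $g^i_1,\dots,g^i_{n_i}$ with identity $g^i_0$, and $|\alpha|$ is the length of $\alpha$. For $X_i=(X_{i,1},\dots,X_{i,n_i})\in B(\mathcal H)^{n_i}$ put $X_{i,\alpha}:=X_{i,j_1}\cdots X_{i,j_p}$ if $\alpha=g^i_{j_1}\cdots g^i_{j_p}$, and $X_{i,g_0^i}:=I$. Fix $\mathbf q=(q_1,\dots,q_k)$, where each $q_i=\sum_{\alpha\in\mathbb F_{n_i}^+}a_{i,\alpha}Z_\alpha$ is a positive regular polynomial in $n_i$ noncommuting indeterminates: a finite sum with $a_{i,\alpha}\ge0$, $a_{i,g_0^i}=0$ and $a_{i,g_j^i}>0$ for $j=1,\dots,n_i$. Define $\Phi_{q_i,X_i}(Y):=\sum_\alpha a_{i,\alpha}X_{i,\alpha}YX_{i,\alpha}^*$ for $Y\in B(\mathcal H)$. $B(\mathcal H)^{n_1}\times_c\cdots\times_cB(\mathcal H)^{n_k}$ is the set of $\mathbf X=(X_1,\dots,X_k)\in B(\mathcal H)^{n_1}\times\cdots\times B(\mathcal H)^{n_k}$ such that, for $s\ne t$, every entry of $X_s$ commutes with every entry of $X_t$. For $\mathbf p\in\{0,1\}^k$ let $\mathbf\Delta^{\mathbf p}_{\mathbf q,\mathbf X}:=(\mathrm{id}-\Phi_{q_1,X_1})^{p_1}\circ\cdots\circ(\mathrm{id}-\Phi_{q_k,X_k})^{p_k}$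 and $\mathbf\Delta_{\mathbf q,\mathbf X}:=\mathbf\Delta^{(1,\dots,1)}_{\mathbf q,\mathbf X}$. Set $\mathbf D^-_{\mathbf q}(\mathcal H):=\{\mathbf X\in B(\mathcal H)^{n_1}\times_c\cdots\times_cB(\mathcal H)^{n_k}:\mathbf\Delta^{\mathbf p}_{\mathbf q,\mathbf X}(I)\ge0\text{ for all }\mathbf p\in\{0,1\}^k\}$ and $\mathbf D_{\mathbf q}(\mathcal H):=\{\mathbf X\in\mathbf D^-_{\mathbf q}(\mathcal H):\mathbf\Delta_{\mathbf q,\mathbf X}(I)>0\}$. For $r>0$, $r\mathbf D_{\mathbf q}(\mathcal H):=\{r\mathbf X:\mathbf X\in\mathbf D_{\mathbf q}(\mathcal H)\}$. Minkowski functional. $m_{\mathbf D_{\mathbf q}}:B(\mathcal H)^{n_1}\times_c\cdots\times_cB(\mathcal H)^{n_k}\to[0,\infty)$, $m_{\mathbf D_{\mathbf q}}(\mathbf X):=\inf\{r>0:\mathbf X\in r\mathbf D_{\mathbf q}(\mathcal H)\}$. Free holomorphic functions. For $\boldsymbol\alpha=(\alpha_1,\dots,\alpha_k)\in\mathbb F_{n_1}^+\times\cdots\times\mathbb F_{n_k}^+$, $\mathbf X_{\boldsymbol\alpha}:=X_{1,\alpha_1}\cdots X_{k,\alpha_k}$. $\Lambda_{\mathbf p}:=\{\boldsymbol\alpha:|\alpha_i|=p_i,\ i=1,\dots,k\}$ for $\mathbf p\in\mathbb Z_+^k$ ($\mathbb Z_+$ the nonnegative integers). A free holomorphic function on $\mathbf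 D_{\mathbf q}$ with scalar coefficients is a formal power series $\sum c_{(\boldsymbol\alpha)}\mathbf Z_{\boldsymbol\alpha}$, $c_{(\boldsymbol\alpha)}\in\mathbb C$, such that $\sum_{\mathbf p\in\mathbb Z_+^k}\sum_{\boldsymbol\alpha\in\Lambda_{\mathbf p}}c_{(\boldsymbol\alpha)}\mathbf X_{\boldsymbol\alpha}$ converges in the operator norm (unordered sum over $\mathbf p$) for every $\mathbf X\in\mathbf D_{\mathbf q}(\mathcal L)$ and every Hilbert space $\mathcal L$; its values are given by the sum. A free holomorphic $F$ with values in $B(\mathcal H)^p$ is a $p$-tuple $F=(F_1,\dots,F_p)$ of such functions; $\|F(\mathbf X)\|$ is the norm of the row operator $[F_1(\mathbf X)\cdots F_p(\mathbf X)]:\mathcal H^{(p)}\to\mathcal H$, and $\|F\|_\infty:=\sup\|F(\mathbf X)\|$ over all $\mathbf X\in\mathbf D_{\mathbf q}(\mathcal L)$ and all Hilbert spaces $\mathcal L$. *)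

(* Defs.v *)
From HB Require Import structures.
From mathcomp Require Import all_boot all_order all_algebra finmap.
From mathcomp Require Import complex sesquilinear.
From mathcomp Require Import boolp classical_sets functions cardinality reals ereal.
From mathcomp Require Import topology normedtype derive.
From mathcomp.analysis.showcase Require Import summability.

Set Implicit Arguments.
Unset Strict Implicit.
Unset Printing Implicit Defensive.

Import Order.TTheory GRing.Theory Num.Theory.
Import numFieldNormedType.Exports.

Local Open Scope classical_set_scope.
Local Open Scope complex_scope.
Local Open Scope ring_scope.

HB.instance Definition _ (R : realType) := NormedModule.copy R[i] R[i]^o.

Section ComplexComplete.
Variable R : realType.

Lemma le_Re_norm (z : R[i]) : `|complex.Re z|%:C <= `|z|.
Proof.
case: z => a b; rewrite normc_def lecR /= -sqrtr_sqr ler_wsqrtr //.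
by rewrite lerDl sqr_ge0.
Qed.

Lemma le_Im_norm (z : R[i]) : `|complex.Im z|%:C <= `|z|.
Proof.
case: z => a b; rewrite normc_def lecR /= -sqrtr_sqr ler_wsqrtr //.
by rewrite lerDr sqr_ge0.
Qed.

Lemma norm_le_ReIm (z : R[i]) :
  `|z| <= (`|complex.Re z| + `|complex.Im z|)%:C.
Proof.
case: z => a b; rewrite normc_def lecR /=.
rewrite -[leRHS]ger0_norm ?addr_ge0// -sqrtr_sqr ler_wsqrtr // sqrrD.
by rewrite !real_normK ?num_real// -addrA lerD2l lerDr mulrn_wge0// mulr_ge0.
Qed.

Lemma complex_complete (F : set_system R[i]) :
  ProperFilter F -> cauchy F -> cvg F.
Proof.
move=> FF /cauchy_ballP Fc.
have part (g : R[i] -> R) : {morph g : x y / x - y} ->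
    (forall z, `|g z|%:C <= `|z|) -> cvg (g @ F).
  move=> gB gle; apply: R_complete; apply/cauchy_ballP => e e0.
  have e0' : (0 : R[i]) < e%:C by rewrite ltcR.
  have := Fc _ e0'.
  case=> -[A B] /= [FA FB] AB.
  exists (g @` A, g @` B) => /=.
    split; [apply: filterS FA | apply: filterS FB] => z Az; by exists z.
  case=> _ _ [/= [x Ax <-] [y By <-]].
  have := AB (x, y) (conj Ax By).
  rewrite /= -!ball_normE /= => xy.
  by rewrite -gB -ltcR; apply: le_lt_trans xy; exact: gle.
have [a Fa] : exists a : R, @complex.Re R @ F --> a.
  by apply/cvg_ex/part; [case=> ? ? [? ?] | exact: le_Re_norm].
have [b Fb] : exists b : R, @complex.Im R @ F --> b.
  by apply/cvg_ex/part; [case=> ? ? [? ?] | exact: le_Im_norm].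
apply/cvg_ex; exists (a +i* b).
apply/cvgrPdist_lt => e e0.
have [e1 e1E] : exists e1 : R, e = e1%:C.
  by exists (complex.Re e); rewrite RRe_real// gtr0_real.
rewrite e1E ltcR in e0; rewrite e1E.
have e20 : 0 < e1 / 2 by rewrite divr_gt0.
move/cvgrPdist_lt : Fa => /(_ _ e20) Fa.
move/cvgrPdist_lt : Fb => /(_ _ e20) Fb.
near=> z.
apply: le_lt_trans (norm_le_ReIm _) _; rewrite ltcR [ltRHS]splitr ltrD//.
  by rewrite raddfB; near: z.
by rewrite raddfB; near: z.
Unshelve. all: by end_near. Qed.

HB.instance Definition _ := Uniform_isComplete.Build R[i] complex_complete.

End ComplexComplete.

(* The inner product is linear in its first argument. *)
HB.mixin Record isHilbert (R : realType) H of CompleteNormedModule R[i] H := {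
  inner : {dot H for (@Num.Def.conjC R[i])};
  norm_inner : forall x : H, `|x| ^+ 2 = inner x x
}.

#[short(type="hilbertType")]
HB.structure Definition Hilbert (R : realType) :=
  {H of isHilbert R H & CompleteNormedModule R[i] H}.

Section ComplexHilbert.
Variable R : realType.

Definition complex_inner (x y : R[i]) : R[i] := x * y^*%R.

Lemma complex_inner_bilinear :
  bilinear_for (GRing.Scale.Law.clone _ _ ( *%R) _ )
    (GRing.Scale.Law.clone _ _ (@Num.Def.conjC R[i] \; *%R) _) complex_inner.
Proof.
split=> [y a x z|x a y z] /=; rewrite /complex_inner.
  by rewrite mulrDl -mulrA.
by rewrite rmorphD rmorphM mulrDr /= mulrCA.
Qed.

HB.instance Definition _ := bilinear_isBilinear.Build R[i] R[i] R[i] R[i]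
  _ _ complex_inner complex_inner_bilinear.

Lemma complex_inner_hermitian (x y : R[i]) :
  complex_inner x y = (-1) ^+ false * (complex_inner y x)^*%R.
Proof. by rewrite expr0 mul1r /complex_inner rmorphM /= conjCK mulrC. Qed.

HB.instance Definition _ := isHermitianSesquilinear.Build R[i] R[i]
  false _ complex_inner complex_inner_hermitian.

Lemma complex_inner_gt0 (x : R[i]) : x != 0 -> 0 < complex_inner x x.
Proof. by move=> x0; rewrite /complex_inner -normCK exprn_gt0// normr_gt0. Qed.

HB.instance Definition _ := isDotProduct.Build R[i] R[i]
  complex_inner complex_inner_gt0.

Lemma complex_norm_inner (x : R[i]) : `|x| ^+ 2 = complex_inner x x.
Proof. exact: normCK. Qed.

HB.instance Definition _ := isHilbert.Build R R[i] complex_norm_inner.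

End ComplexHilbert.

(* The norm of a normed module over R[i] takes values in R[i]; nrm is the same
   norm as a real number. *)
Definition nrm (R : realType) (V : normedModType R[i]) (x : V) : R :=
  complex.Re `|x|.

Lemma nrmE (R : realType) (V : normedModType R[i]) (x : V) :
  `|x| = (nrm x)%:C.
Proof. by rewrite /nrm RRe_real ?normr_real. Qed.

Section BoundedOperators.
Variables (R : realType) (H : normedModType R[i]).

Definition bounded_op : {pred H -> H} :=
  [pred T | `[< linear T /\ exists M : R, forall x, `|T x| <= M%:C * `|x| >]].

Record bop := Bop { bop_fun :> H -> H; bop_subproof : bop_fun \in bounded_op }.

HB.instance Definition _ := [isSub for bop_fun].
HB.instance Definition _ := [Choice of bop by <:].

Lemma bounded_op_submod_closed : submod_closed bounded_op.
Proof.
split=> [|a S T].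
  apply/asboolP; split=> [b x y|]; first by rewrite scaler0 addr0.
  by exists 0 => x; rewrite normr0 mul0r.
move=> /asboolP[lS [M SM]] /asboolP[lT [N TN]]; apply/asboolP; split.
  move=> b x y; rewrite !fctE lS lT !scalerDr addrACA; congr (_ + _ + _).
  by rewrite !scalerA mulrC.
exists (nrm (a : R[i]) * M + N) => x.
apply: le_trans (ler_normD _ _) _.
rewrite rmorphD mulrDl lerD//= normrZ rmorphM/= -mulrA.
by rewrite (nrmE (a : R[i])) ler_wpM2l// -nrmE normr_ge0.
Qed.

HB.instance Definition _ :=
  GRing.isSubmodClosed.Build R[i] (H -> H) bounded_op bounded_op_submod_closed.
HB.instance Definition _ := [SubChoice_isSubLmodule of bop by <:].

Lemma bopP (S T : bop) : (forall x, S x = T x) -> S = T.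
Proof. by move=> ST; apply/val_inj/funext. Qed.

Lemma bop_linear (T : bop) : linear T.
Proof. by have /asboolP[] := bop_subproof T. Qed.

HB.instance Definition _ (T : bop) :=
  GRing.isLinear.Build R[i] H H *:%R T (bop_linear T).

Lemma bop_bounded (T : bop) :
  exists2 M : R, 0 <= M & forall x, nrm (T x) <= M * nrm x.
Proof.
have /asboolP[_ [M TM]] := bop_subproof T; exists `|M| => // x.
rewrite -lecR -nrmE; apply: le_trans (TM x) _.
by rewrite nrmE -rmorphM/= lecR ler_wpM2r ?ler_norm// -lecR -nrmE normr_ge0.
Qed.

Lemma bop_addE (S T : bop) x : (S + T) x = S x + T x. Proof. by []. Qed.
Lemma bop_scaleE a (T : bop) x : (a *: T) x = a *: T x. Proof. by []. Qed.
Lemma bop_zeroE x : (0 : bop) x = 0. Proof. by []. Qed.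

Lemma bop_one_subproof : idfun \in bounded_op.
Proof. by apply/asboolP; split=> //; exists 1 => x; rewrite mul1r. Qed.

Definition bop_one : bop := Bop bop_one_subproof.

Lemma bop_comp_subproof (S T : bop) : S \o T \in bounded_op.
Proof.
apply/asboolP; split=> [a x y|]; first by rewrite /= !linearP.
have [M M0 SM] := bop_bounded S; have [N N0 TN] := bop_bounded T.
exists (M * N) => x; rewrite !nrmE -rmorphM lecR /=.
by apply: le_trans (SM _) _; rewrite -mulrA ler_wpM2l.
Qed.

Definition bop_comp (S T : bop) : bop := Bop (bop_comp_subproof S T).

Lemma bop_compA : associative bop_comp.
Proof. by move=> ? ? ?; apply: bopP. Qed.
Lemma bop_comp1l : left_id bop_one bop_comp.
Proof. by move=> ?; apply: bopP. Qed.
Lemma bop_comp1r : right_id bop_one bop_comp.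
Proof. by move=> ?; apply: bopP. Qed.
Lemma bop_compDl : left_distributive bop_comp +%R.
Proof. by move=> ? ? ?; apply: bopP. Qed.
Lemma bop_compDr : right_distributive bop_comp +%R.
Proof.
move=> S T U; apply: bopP => x.
exact: (linearD S).
Qed.

HB.instance Definition _ := GRing.Zmodule_isPzRing.Build bop
  bop_compA bop_comp1l bop_comp1r bop_compDl bop_compDr.

Definition unit_image (T : bop) : set R :=
  [set nrm (T x) | x in [set x : H | nrm x <= 1]].

Definition opnorm (T : bop) : R := sup (unit_image T).

Lemma nrm_ge0 (x : H) : 0 <= nrm x.
Proof. by rewrite -lecR -nrmE normr_ge0. Qed.
Lemma nrm0 : nrm (0 : H) = 0. Proof. by rewrite /nrm normr0. Qed.
Lemma nrmZ (a : R[i]) (x : H) : nrm (a *: x) = nrm a * nrm x.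
Proof. by apply: complexI; rewrite rmorphM/= -!nrmE normrZ. Qed.

Lemma has_sup_unit_image (T : bop) : has_sup (unit_image T).
Proof.
split; first by exists (nrm (T 0)), 0 => //=; rewrite nrm0.
have [M M0 TM] := bop_bounded T; exists M => _ [x /= x1 <-].
by apply: le_trans (TM x) _; rewrite ler_piMr.
Qed.

Lemma opnorm_ub (T : bop) (x : H) : nrm x <= 1 -> nrm (T x) <= opnorm T.
Proof.
by move=> x1; apply: sup_upper_bound; [exact: has_sup_unit_image | exists x].
Qed.

Lemma opnorm_le (T : bop) (M : R) :
  (forall x, nrm x <= 1 -> nrm (T x) <= M) -> opnorm T <= M.
Proof.
move=> TM; apply: ge_sup; first by have [] := has_sup_unit_image T.
by move=> _ [x /= x1 <-]; exact: TM.
Qed.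

Lemma opnorm_ge0 (T : bop) : 0 <= opnorm T.
Proof. by apply: le_trans (nrm_ge0 (T 0)) _; rewrite opnorm_ub// nrm0. Qed.

Lemma opnormP (T : bop) (x : H) : nrm (T x) <= opnorm T * nrm x.
Proof.
have [->|x0] := eqVneq x 0; first by rewrite linear0 nrm0 mulr0.
have nx0 : 0 < nrm x by rewrite -ltcR -nrmE normr_gt0.
rewrite -ler_pdivrMr//.
have inv_nrm : nrm ((nrm x)^-1%:C : R[i]) = (nrm x)^-1.
  by apply: complexI; rewrite -nrmE ger0_norm// lecR invr_ge0 nrm_ge0.
have := @opnorm_ub T ((nrm x)^-1%:C *: x).
by rewrite linearZ/= !nrmZ inv_nrm mulVf ?gt_eqF// mulrC; apply.
Qed.

Definition opnormC (T : bop) : R[i] := (opnorm T)%:C.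

Lemma opnormC_triangle (S T : bop) : opnormC (S + T) <= opnormC S + opnormC T.
Proof.
rewrite /opnormC -rmorphD lecR; apply: opnorm_le => x x1.
apply: (@le_trans _ _ (nrm (S x) + nrm (T x))).
  by rewrite -lecR rmorphD/= -!nrmE; exact: ler_normD.
by rewrite lerD ?opnorm_ub.
Qed.

Lemma opnormCZ (a : R[i]) (T : bop) : opnormC (a *: T) = `|a| * opnormC T.
Proof.
rewrite (nrmE a) /opnormC -rmorphM; congr _%:C; apply/eqP.
have na0 : 0 <= nrm a by rewrite -lecR -nrmE normr_ge0.
rewrite eq_le; apply/andP; split.
  by apply: opnorm_le => x x1; rewrite bop_scaleE nrmZ ler_wpM2l// opnorm_ub.
have [->|a0] := eqVneq a 0.
  by rewrite /nrm normr0 mul0r opnorm_ge0.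
have {}na0 : 0 < nrm a by rewrite -ltcR -nrmE normr_gt0.
rewrite -ler_pdivlMl//; apply: opnorm_le => x x1.
by rewrite ler_pdivlMl// -nrmZ -bop_scaleE opnorm_ub.
Qed.

Lemma opnormC_eq0 (T : bop) : opnormC T = 0 -> T = 0.
Proof.
move=> /complexI T0; apply: bopP => x; apply/eqP.
rewrite -normr_eq0 nrmE; apply/eqP; congr _%:C; apply/eqP.
by rewrite eq_le nrm_ge0 andbT; have := opnormP T x; rewrite T0 mul0r.
Qed.

HB.instance Definition _ :=
  Lmodule_isNormed.Build R[i] bop opnormC_triangle opnormCZ opnormC_eq0.

End BoundedOperators.

Section Polydomain.
Variable R : realType.

(* The condition determines S, and S exists by Riesz representation; the default
   value 0 of xget is never used. *)
Definition adjoint (H : hilbertType R) (T : bop H) : bop H :=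
  xget 0 [set S : bop H | forall x y, inner (T x) y = inner x (S y)].

Definition positive_op (H : hilbertType R) (T : bop H) : Prop :=
  forall x, 0 <= inner (T x) x.

Definition invertible_op (H : hilbertType R) (T : bop H) : Prop :=
  exists S : bop H, S * T = 1 /\ T * S = 1.

Definition separable (H : hilbertType R) : Prop :=
  exists2 D : set H, countable D & dense D.

Definition infinite_dimensional (H : hilbertType R) : Prop :=
  ~ exists (d : nat) (v : 'I_d -> H),
      forall x : H, exists a : 'I_d -> R[i], x = \sum_(l < d) a l *: v l.

(* Polynomials in noncommuting Z_1, ..., Z_n: finitely supported coefficient
   families on words, the word [:: j1; ...; jp] standing for Z_j1 ... Z_jp. *)
Definition ncpoly (n : nat) := {fsfun seq 'I_n -> R with 0}.

Definition positive_regular (n : nat) (q : ncpoly n) : Prop :=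
  [/\ forall w, 0 <= q w, q [::] = 0 & forall j, 0 < q [:: j]].

Definition word_op (H : hilbertType R) (n : nat) (X : 'I_n -> bop H)
  (w : seq 'I_n) : bop H := \prod_(j <- w) X j.

Definition Phi (H : hilbertType R) (n : nat) (q : ncpoly n)
    (X : 'I_n -> bop H) (Y : bop H) : bop H :=
  \sum_(w <- finsupp q) (q w)%:C *: (word_op X w * Y * adjoint (word_op X w)).

Variables (k : nat) (n : 'I_k -> nat).

Definition optuple (H : hilbertType R) := forall i : 'I_k, 'I_(n i) -> bop H.

Definition cross_commuting (H : hilbertType R) (X : optuple H) : Prop :=
  forall s t, s != t -> forall j l, X s j * X t l = X t l * X s j.

Definition scale_tuple (H : hilbertType R) (r : R) (X : optuple H) :
  optuple H := fun i j => r%:C *: X i j.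

Section Domain.
Variable q : forall i : 'I_k, ncpoly (n i).

Definition defect (H : hilbertType R) (X : optuple H) (p : 'I_k -> bool) :
    bop H -> bop H :=
  \big[(fun f g => f \o g)/idfun]_(i < k)
    iter (p i) (fun Y => Y - Phi (q i) (X i) Y).

Definition closed_polydomain (H : hilbertType R) : set (optuple H) :=
  [set X | cross_commuting X /\ forall p, positive_op (defect X p 1)].

Definition polydomain (H : hilbertType R) : set (optuple H) :=
  [set X | [/\ closed_polydomain X, positive_op (defect X xpredT 1)
             & invertible_op (defect X xpredT 1)]].

Definition scaled_polydomain (H : hilbertType R) (r : R) : set (optuple H) :=
  [set scale_tuple r X | X in @polydomain H].

Definition minkowski (H : hilbertType R) (X : optuple H) : R :=
  inf [set r : R | 0 < r /\ scaled_polydomain r X].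

End Domain.

Definition multiword := forall i : 'I_k, seq 'I_(n i).

Definition multiword_op (H : hilbertType R) (X : optuple H) (a : multiword) :
  bop H := \prod_(i < k) word_op (X i) (a i).

Definition free_series := multiword -> R[i].

(* The sum over Lambda_p: the words with |a_i| = p_i are the p_i-tuples. *)
Definition homogeneous_part (c : free_series) (H : hilbertType R)
    (X : optuple H) (p : {ffun 'I_k -> nat}) : bop H :=
  \sum_(a : {dffun forall i : 'I_k, (p i).-tuple 'I_(n i)})
    c (fun i => a i) *: multiword_op X (fun i => a i).

(* totally is the filter of finite index sets ordered by inclusion, so this is
   unordered summability in the operator norm of bop L. *)
Definition free_holomorphic (q : forall i, ncpoly (n i)) (c : free_series) :
    Prop :=
  forall (L : hilbertType R) (X : optuple L), polydomain q X ->
    cvg (partial_sum (homogeneous_part c X) @ totally).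

Definition free_eval (c : free_series) (H : hilbertType R) (X : optuple H) :
  bop H := summability.sum (homogeneous_part c X).

(* The norm of [T_1 ... T_m] as an operator from the Hilbert space direct sum
   of m copies of H to H. *)
Definition row_norm (H : hilbertType R) (m : nat) (T : 'I_m -> bop H) : R :=
  sup [set nrm (\sum_(l < m) T l (x l)) |
         x in [set x : 'I_m -> H | \sum_(l < m) nrm (x l) ^+ 2 <= 1]].

Definition sup_norm (q : forall i, ncpoly (n i)) (m : nat)
    (F : 'I_m -> free_series) : \bar R :=
  ereal_sup [set e | exists (L : hilbertType R) (X : optuple L),
    polydomain q X /\ e = (row_norm (fun l => free_eval (F l) X))%:E].

(* C is the Hilbert space R[i], and B(C) is identified with C through T |-> T 1. *)
Definition scalar_representation (c : free_series)
    (z : forall i : 'I_k, 'I_(n i) -> R[i]) : R[i] :=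
  free_eval c ((fun i j => z i j *: (1 : bop R[i])) : optuple R[i]) 1.

Definition partial_derivative (f : (forall i : 'I_k, 'I_(n i) -> R[i]) -> R[i])
    (i : 'I_k) (j : 'I_(n i)) (z : forall i : 'I_k, 'I_(n i) -> R[i]) : R[i] :=
  derive1 (fun h : R[i] => f (dfwith z (@dfwith _ (fun=> R[i]) (z i) j h))) (z i j).

End Polydomain.

(* Main.v *)
Require Import Defs.
From mathcomp Require Import all_boot all_order all_algebra finmap.
From mathcomp Require Import complex sesquilinear boolp classical_sets reals.
From mathcomp Require Import ereal topology normedtype derive mathcomp_extra.
From mathcomp Require cyclic separable cyclotomic.
From mathcomp.analysis.showcase Require Import summability.
From mathcomp Require Import ring lra zify.

Set Implicit Arguments.
Unset Strict Implicit.
Unset Printing Implicit Defensive.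

Import Order.TTheory GRing.Theory Num.Theory.
Import numFieldNormedType.Exports.

Local Open Scope classical_set_scope.
Local Open Scope complex_scope.
Local Open Scope fset_scope.
Local Open Scope ring_scope.

(** A point X of the polydomain is written X = r Y with Y in the polydomain and
    0 < r <= 1, and the function z |-> F(z Y) is compared with z on the unit
    disc; the Minkowski functional is the infimum of the admissible r.

    Three facts about the polydomain make this possible.  It is invariant under
    Y |-> a Y for complex |a| <= 1, so that F(z Y) makes sense on the closed
    disc, and it is open along rays, so that the Minkowski functional is less
    than 1 on it.  Both come from [defect_domination].  Replacing Y by a Y, or
    deleting a factor from the defect, changes id - Phi_i into
    (id - Phi_i) + P_i with P_i a positive map that commutes with the other
    factors; expanding the product of these factors, every defect of a Y
    exceeds the full defect of Y by a sum of positive maps applied to defects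
    of Y.  The full defect is positive and invertible, hence bounded below by a
    constant d > 0, and all the defects of a Y are bounded below by the same d.
    Defects depend continuously on scaling, so that a lower bound survives a
    slightly larger factor ([polydomain_open]), and an operator with a positive
    lower bound is again invertible ([coercive_invertible]).  The third fact is
    that small multiples of any commuting tuple lie in the polydomain, because
    all the defects of the zero tuple are the identity.

    For the Schwarz lemma, x in the unit ball of H^(p) is fixed and F(z Y) x is
    paired with the vector v = F(r Y) x.  The resulting scalar function of z is
    an unordered power series without constant term, bounded by |v| on the unit
    circle, so at z = r its value |v|^2 is at most r |v|.  This scalar statement
    is proved without integration: unordered summability of scalars is
    absolute, which reduces it to polynomials; coefficients of a polynomial are
    bounded by averaging over roots of unity; and applying this bound to high
    powers of the polynomial gives the maximum modulus principle.

    The linear part psi of F is treated in the same way, with the estimate of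
    the first coefficient instead of the maximum principle, which gives
    |psi(Y)| <= 1 and thus |psi(r Y)| <= r.  The coefficients of psi are the
    partial derivatives at 0 of the scalar representation, since the remainder
    of an absolutely summable series without constant term is quadratic. *)

(** * Norms with real values *)

Section RealNorms.
Variables (R : realType) (V : normedModType R[i]).
Implicit Types (a b : R[i]).

Lemma Re_conj (a : R[i]) : complex.Re (a^*%R) = complex.Re a.
Proof. by case: a. Qed.
Lemma Re_realM (c : R) (a : R[i]) : complex.Re (c%:C * a) = c * complex.Re a.
Proof. by case: a => u v /=; rewrite mul0r subr0. Qed.
Lemma Im_realM (c : R) (a : R[i]) : complex.Im (c%:C * a) = c * complex.Im a.
Proof. by case: a => u v /=; rewrite mul0r addr0. Qed.
Lemma Im_add a b :
  complex.Im (a + b) = complex.Im a + complex.Im b.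
Proof. by case: a b => ? ? []. Qed.

Lemma nrm_real (c : R) : nrm (c%:C : R[i]) = `|c|.
Proof. by apply: complexI; rewrite -nrmE normc_def /= expr0n /= addr0 sqrtr_sqr. Qed.

Lemma nrmM a b : nrm (a * b : R[i]) = nrm (a : R[i]) * nrm (b : R[i]).
Proof. by apply: complexI; rewrite rmorphM /= -!nrmE normrM. Qed.

Lemma nrmX a m : nrm (a ^+ m : R[i]) = nrm (a : R[i]) ^+ m.
Proof. by apply: complexI; rewrite rmorphXn /= -!nrmE normrX. Qed.

Lemma nrm_add (x y : V) : nrm (x + y) <= nrm x + nrm y.
Proof. by rewrite -lecR rmorphD/= -!nrmE ler_normD. Qed.

Lemma nrm_opp (x : V) : nrm (- x) = nrm x.
Proof. by rewrite /nrm normrN. Qed.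

Lemma nrm_sum (I : Type) (r : seq I) (P : pred I) (F : I -> V) :
  nrm (\sum_(i <- r | P i) F i) <= \sum_(i <- r | P i) nrm (F i).
Proof.
elim/big_ind2: _ => //; first by rewrite nrm0.
by move=> x1 x2 y1 y2 h1 h2; apply: le_trans (nrm_add _ _) _; exact: lerD.
Qed.

Lemma nrm_Re_Im a : nrm (a : R[i]) <= `|complex.Re a| + `|complex.Im a|.
Proof. by rewrite -lecR -nrmE norm_le_ReIm. Qed.

Lemma nrm_eq0 (x : V) : nrm x = 0 -> x = 0.
Proof. by move=> x0; apply/eqP; rewrite -normr_eq0 nrmE x0. Qed.

Lemma real_radius (e : R[i]) : 0 < e -> exists2 r : R, 0 < r & e = r%:C.
Proof.
move=> e0; exists (complex.Re e); last by rewrite RRe_real// gtr0_real.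
by rewrite -ltcR RRe_real// gtr0_real.
Qed.

Lemma cvg_nrmP (F : set_system V) {FF : Filter F} (l : V) :
  F --> l <-> forall e : R, 0 < e -> \forall x \near F, nrm (l - x) < e.
Proof.
split=> [/cvgrPdist_lt Fl e e0|Fl].
  have e0' : (0 : R[i]) < e%:C by rewrite ltcR.
  by near=> x; rewrite -ltcR -nrmE; near: x; exact: Fl.
apply/cvgrPdist_lt => e /real_radius[r r0 ->].
by near=> x; rewrite nrmE ltcR; near: x; exact: Fl.
Unshelve. all: by end_near. Qed.

End RealNorms.

(** * The real inner product of a Hilbert space *)

Section RealInner.
Variables (R : realType) (H : hilbertType R).
Implicit Types (x y z : H) (T S : bop H).

Lemma bopM S T x : (S * T) x = S (T x). Proof. by []. Qed.
Lemma bopD T x y : T (x + y) = T x + T y. Proof. exact: linearD. Qed.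
Lemma bopZ T a x : T (a *: x) = a *: T x. Proof. exact: linearZ. Qed.
Lemma bopB T x y : T (x - y) = T x - T y. Proof. exact: linearB. Qed.

Definition ip x y : R := complex.Re (inner x y).

Lemma innerDl x y z : inner (x + y) z = inner x z + inner y z.
Proof. exact: linearDl. Qed.
Lemma innerDr x y z : inner x (y + z) = inner x y + inner x z.
Proof. exact: linearDr. Qed.
Lemma innerZl a x y : inner (a *: x) y = a * inner x y.
Proof. exact: linearZl_LR. Qed.
Lemma innerZr a x y : inner x (a *: y) = a^*%R * inner x y.
Proof. exact: linearZr_LR. Qed.
Lemma innerC x y : inner y x = (inner x y)^*%R.
Proof. by rewrite hermC expr0 mul1r. Qed.
Lemma innerBl x y z : inner (x - y) z = inner x z - inner y z.
Proof. exact: linearBl. Qed.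
Lemma innerBr x y z : inner x (y - z) = inner x y - inner x z.
Proof. exact: linearBr. Qed.

Lemma ipC x y : ip x y = ip y x.
Proof. by rewrite /ip innerC Re_conj. Qed.
Lemma ipDl x y z : ip (x + y) z = ip x z + ip y z.
Proof. by rewrite /ip innerDl raddfD. Qed.
Lemma ipDr x y z : ip x (y + z) = ip x y + ip x z.
Proof. by rewrite /ip innerDr raddfD. Qed.
Lemma ipBl x y z : ip (x - y) z = ip x z - ip y z.
Proof. by rewrite /ip innerBl raddfB. Qed.
Lemma ipBr x y z : ip x (y - z) = ip x y - ip x z.
Proof. by rewrite /ip innerBr raddfB. Qed.
Lemma ipZl (c : R) x y : ip (c%:C *: x) y = c * ip x y.
Proof. by rewrite /ip innerZl Re_realM. Qed.
Lemma ipZr (c : R) x y : ip x (c%:C *: y) = c * ip x y.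
Proof. by rewrite ipC ipZl ipC. Qed.

Lemma nrm_sqr x : nrm x ^+ 2 = ip x x.
Proof. by rewrite /ip -norm_inner nrmE -rmorphXn. Qed.

Lemma ip_le x y : ip x y <= nrm x * nrm y.
Proof.
have : nrm (x + y) ^+ 2 <= (nrm x + nrm y) ^+ 2.
  by rewrite ler_sqr ?nnegrE ?addr_ge0 ?nrm_ge0// nrm_add.
rewrite nrm_sqr ipDl !ipDr (ipC y x) -!nrm_sqr sqrrD; lra.
Qed.

Lemma ip_norm_le x y : `|ip x y| <= nrm x * nrm y.
Proof.
rewrite ler_norml ip_le andbT lerNl; apply: le_trans (_ : ip (- x) y <= _).
  by rewrite -[- x]sub0r ipBl /ip linear0l /= sub0r.
by rewrite -(nrm_opp x) ip_le.
Qed.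

Lemma innerE x y : inner x y = ip x y +i* (- ip ('i *: x) y).
Proof.
rewrite /ip innerZl; case: (inner x y) => a b /=.
by rewrite mul0r mul1r sub0r opprK.
Qed.

Lemma ip_inj x y : (forall z, ip z x = ip z y) -> x = y.
Proof.
move=> xy; apply/eqP; rewrite -subr_eq0; apply/eqP/nrm_eq0/eqP.
by rewrite -sqrf_eq0 nrm_sqr ipBr xy subrr.
Qed.

Definition real_form T := forall x, complex.Im (inner (T x) x) = 0.

Lemma positive_opP T :
  positive_op T <-> real_form T /\ (forall x, 0 <= ip (T x) x).
Proof.
split=> [T0|[T1 T2] x].
  by split=> x; have := T0 x; rewrite lecE => /andP[/eqP/= ? ?].
by rewrite lecE /= T1 eqxx T2.
Qed.

(** Polarization, along x + y and x + i y. *)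
Lemma real_form_symmetric T : real_form T ->
  forall x y, inner (T x) y = inner x (T y).
Proof.
move=> T0 x y; rewrite (innerC (T y) x).
have := T0 (x + y); have := T0 (x + 'i *: y).
rewrite !bopD !bopZ !innerDl !innerDr !innerZl !innerZr !raddfD /=.
have := T0 x; have := T0 y.
case: (inner (T x) x) => ? ? /=; case: (inner (T y) y) => ? ? /=.
case: (inner (T x) y) => a b /=; case: (inner (T y) x) => c d /= -> ->.
move=> h1 h2; apply/eqP; rewrite eq_complex /=.
by apply/andP; split; apply/eqP; lra.
Qed.

Definition coercive (d : R) T := forall x, d * nrm x ^+ 2 <= ip (T x) x.

End RealInner.

(** * Minimizing the energy: adjoints and inverses *)

Section LaxMilgram.
Variables (R : realType) (H : hilbertType R).
Variables (T : bop H) (d : R) (f : H -> R) (M : R).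
Hypotheses (d0 : 0 < d) (Tsym : forall x y, ip (T x) y = ip x (T y)).
Hypothesis Tco : coercive d T.
Hypotheses (fD : forall x y, f (x + y) = f x + f y)
  (fZ : forall (c : R) x, f (c%:C *: x) = c * f x)
  (fM : forall x, `|f x| <= M * nrm x).

Let J x := ip (T x) x - 2 * f x.

Let J_add x (s : R) z : J (x + s%:C *: z) =
  J x + 2 * s * (ip z (T x) - f z) + s ^+ 2 * ip (T z) z.
Proof.
rewrite /J bopD bopZ !ipDl !ipDr !ipZl !ipZr fD fZ.
rewrite (Tsym z x) (ipC (T x) z); ring.
Qed.

Let J_lb x : - (M ^+ 2 / d) <= J x.
Proof.
have h1 := Tco x; have := fM x; rewrite ler_norml => /andP[_ h2].
have : 0 <= (d * nrm x - M) ^+ 2 / d by rewrite divr_ge0 ?sqr_ge0 ?ltW.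
have -> : (d * nrm x - M) ^+ 2 / d = d * nrm x ^+ 2 - 2 * (M * nrm x) + M ^+ 2 / d.
  by field; rewrite gt_eqF.
rewrite /J; lra.
Qed.

Let m := inf (range J).

Let hinf : has_inf (range J).
Proof. by split; [exists (J 0), 0 | exists (- (M ^+ 2 / d)) => _ [x _ <-]]. Qed.

Let m_le x : m <= J x.
Proof. by apply: ge_inf; [exact: hinf.2 | exists x]. Qed.

Let near_min e : 0 < e -> exists x, J x < m + e.
Proof. by move=> e0; have [_ [x _ <-] h] := inf_adherent e0 hinf; exists x. Qed.

Let parallelogram x y (e : R) : J x < m + e -> J y < m + e ->
  d * nrm (x - y) ^+ 2 <= 4 * e.
Proof.
move=> Jx Jy; apply: le_trans (Tco _) _.
have := m_le (y + (2^-1)%:C *: (x - y)); rewrite J_add.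
have : J x = J (y + 1%:C *: (x - y)) by rewrite scale1r addrC subrK.
rewrite J_add; lra.
Qed.

(** The energy <Tx,x> - 2 f(x) is bounded below by coercivity, and the
    parallelogram law makes its minimizing sequences Cauchy.  At the limit the
    first variation of the energy vanishes in every direction. *)
Lemma lax_milgram : exists u, forall z, f z = ip z (T u).
Proof.
have /choice[v vP] : forall k : nat, exists x, J x < m + k.+1%:R^-1.
  by move=> k; apply: near_min; rewrite invr_gt0.
have vv (k l : nat) : (k <= l)%N -> d * nrm (v k - v l) ^+ 2 <= 4 * k.+1%:R^-1.
  move=> kl; apply: parallelogram => //; apply: lt_le_trans (vP l) _.
  by rewrite lerD2l lef_pV2 ?posrE// ler_nat.
have small (e : R) : 0 < e -> \forall k \near \oo, (k.+1%:R^-1 : R) < e.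
  move=> e0; near=> k; rewrite invf_plt ?posrE//.
  apply: le_lt_trans (_ : k%:R < _); last by rewrite ltr_nat.
  by near: k; exact: nbhs_infty_ger.
have Cv : cvg (v @ \oo).
  apply/cauchy_cvgP/cauchy_exP => e /real_radius[r r0 ->].
  have r0' : 0 < d * r ^+ 2 / 4 by rewrite divr_gt0 ?mulr_gt0 ?exprn_gt0.
  have [k _ kP] := small _ r0'.
  exists (v k); exists k => // l /= kl.
  rewrite -ball_normE /= nrmE ltcR -ltr_sqr ?nnegrE ?nrm_ge0 ?ltW//.
  rewrite -(ltr_pM2l d0); apply: le_lt_trans (vv _ _ kl) _.
  by rewrite mulrC -ltr_pdivlMr//; exact: kP k (leqnn k).
have /cvg_ex[u /cvg_nrmP vu] := Cv.
exists u => z; set g := ip z (T u) - f z; suff : g = 0 by rewrite /g; lra.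
set t := ip (T z) z.
have t0 : 0 <= t by apply: le_trans (Tco z); rewrite mulr_ge0 ?sqr_ge0 ?ltW.
have var (s : R) : 0 <= 2 * s * g + s ^+ 2 * t.
  set c := 1 + 2 * `|s| * nrm (T z).
  have c0 : 0 < c by rewrite ltr_pwDl// !mulr_ge0 ?nrm_ge0.
  apply/ler_addgt0Pr => e e0.
  have e'0 : 0 < e / c by rewrite divr_gt0.
  near \oo => k.
  have uk : nrm (u - v k) < e / c by near: k; exact: vu.
  have ek : (k.+1%:R^-1 : R) < e / c by near: k; exact: small.
  have := m_le (v k + s%:C *: z); rewrite J_add -/t => h.
  have h1 : J (v k) < m + e / c by apply: lt_trans (vP k) _; rewrite ltrD2l.
  have h2 : 0 <= 2 * s * (ip z (T (v k)) - f z) + s ^+ 2 * t + e / c by lra.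
  have h3 : 2 * s * (ip z (T (v k)) - f z) <= 2 * s * g + 2 * `|s| * nrm (T z) * (e / c).
    have -> : 2 * s * (ip z (T (v k)) - f z) = 2 * s * g - 2 * (s * ip (T z) (u - v k)).
      by rewrite /g ipBr -!Tsym; ring.
    rewrite lerD2l -mulrN -!mulrA ler_pM2l//.
    rewrite lerNl; apply: le_trans (_ : - `|s * ip (T z) (u - v k)| <= _); last by rewrite lerNl -normrN ler_norm.
    rewrite lerN2 normrM ler_wpM2l//; apply: le_trans (ip_norm_le _ _) _.
    by rewrite ler_wpM2l ?nrm_ge0// ltW.
  have -> : e = c * (e / c) by field; rewrite gt_eqF.
  rewrite {1}/c; lra.
have := var (- g / (t + 1)).
have -> : 2 * (- g / (t + 1)) * g + (- g / (t + 1)) ^+ 2 * t =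
   - (g ^+ 2 * ((t + 2) / (t + 1) ^+ 2)) by field; rewrite gt_eqF// ltr_wpDl.
rewrite oppr_ge0 => h; apply/eqP; rewrite -sqrf_eq0 eq_le sqr_ge0 andbT.
have q0 : 0 < (t + 2) / (t + 1) ^+ 2 by rewrite divr_gt0 ?exprn_gt0 ?ltr_wpDl.
by move: h; rewrite pmulr_lle0.
Unshelve. all: by end_near. Qed.

End LaxMilgram.

Section Operators.
Variables (R : realType) (H : hilbertType R).
Implicit Types (x y z : H) (T S : bop H).

Lemma opnorm_ip T x y : `|ip (T x) y| <= opnorm T * nrm x * nrm y.
Proof.
apply: le_trans (ip_norm_le _ _) _.
by rewrite ler_wpM2r ?nrm_ge0// opnormP.
Qed.

Lemma bop_build (g : H -> H) (M : R) : (forall a x y, g (a *: x + y) = a *: g x + g y) ->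
  (forall x, nrm (g x) <= M * nrm x) -> exists S : bop H, forall x, S x = g x.
Proof.
move=> glin gM.
have gP : g \in @bounded_op R H.
  apply/asboolP; split=> //; exists M => x.
  by rewrite !nrmE -rmorphM/= lecR.
by exists (Bop gP).
Qed.

(** The case T = 1 of the energy argument. *)
Lemma riesz (f : H -> R) (M : R) :
  (forall x y, f (x + y) = f x + f y) ->
  (forall (c : R) x, f (c%:C *: x) = c * f x) ->
  (forall x, `|f x| <= M * nrm x) -> exists u, forall z, f z = ip z u.
Proof.
move=> fD fZ fM.
have := @lax_milgram R H 1 1 f M ltr01 (fun _ _ => erefl) _ fD fZ fM.
by apply=> x; rewrite mul1r nrm_sqr.
Qed.

(** The Riesz vector of z |-> Re <Tz, y> represents z |-> <Tz, y> as well, since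
    imaginary parts are real parts at i z. *)
Lemma adjoint_exists T : exists S : bop H, forall x y, inner (T x) y = inner x (S y).
Proof.
have [M M0 TM] := bop_bounded T.
have /choice[g gP] : forall y, exists u, forall z, ip (T z) y = ip z u.
  move=> y; apply: (@riesz _ (M * nrm y)) => [x z|c x|x].
  - by rewrite bopD ipDl.
  - by rewrite bopZ ipZl.
  - apply: le_trans (ip_norm_le _ _) _; rewrite mulrAC.
    by rewrite ler_wpM2r ?nrm_ge0.
have gI x y : inner (T x) y = inner x (g y) by rewrite !innerE -bopZ !gP.
have [S SP] : exists S : bop H, forall x, S x = g x.
  apply: (@bop_build _ M) => [a x y|x].
    apply: ip_inj => z; congr complex.Re.
    by rewrite -gI !innerDr !innerZr -!gI.
  have [->|gx] := eqVneq (nrm (g x)) 0; first by rewrite mulr_ge0 ?nrm_ge0.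
  have gx0 : 0 < nrm (g x) by rewrite lt_neqAle eq_sym gx nrm_ge0.
  rewrite -(ler_pM2r gx0) -expr2 nrm_sqr -gP.
  apply: le_trans (ip_le _ _) _; rewrite mulrAC ler_wpM2r ?nrm_ge0//.
by exists S => x y; rewrite SP.
Qed.

Lemma adjointP T x y : inner (T x) y = inner x (adjoint T y).
Proof. by have := xgetPex 0 (adjoint_exists T); apply. Qed.

Lemma adjoint_unique T S : (forall x y, inner (T x) y = inner x (S y)) -> adjoint T = S.
Proof.
move=> TS; apply: bopP => y; apply: ip_inj => z; congr complex.Re.
by rewrite -adjointP TS.
Qed.

Lemma adjointM S T : adjoint (S * T) = adjoint T * adjoint S.
Proof. by apply: adjoint_unique => x y; rewrite !bopM !adjointP. Qed.

Lemma adjointZ (a : R[i]) T : adjoint (a *: T) = a^*%R *: adjoint T.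
Proof.
apply: adjoint_unique => x y.
by rewrite !bop_scaleE innerZl adjointP innerZr conjCK.
Qed.

(** Energy minimization for z |-> Re <z, y> gives surjectivity, and coercivity
    bounds the inverse. *)
Lemma coercive_invertible T d : 0 < d ->
  real_form T -> coercive d T -> invertible_op T.
Proof.
move=> d0 Tim Tco.
have Tsym x y : ip (T x) y = ip x (T y) by rewrite /ip real_form_symmetric.
have Tlow x : d * nrm x <= nrm (T x).
  have [->|x0] := eqVneq (nrm x) 0; first by rewrite mulr0 nrm_ge0.
  have x00 : 0 < nrm x by rewrite lt_neqAle eq_sym x0 nrm_ge0.
  rewrite -(ler_pM2r x00) -mulrA -expr2; apply: le_trans (Tco x) _.
  exact: ip_le.
have /choice[g gP] : forall y, exists u, T u = y.
  move=> y; have [|c x|x|u uP] := @lax_milgram R H T d (fun x => ip x y) (nrm y) d0 Tsym Tco.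
  - by move=> x z; rewrite ipDl.
  - by rewrite ipZl.
  - by rewrite mulrC ip_norm_le.
  - by exists u; apply: ip_inj => z; rewrite -uP.
have Tinj x y : T x = T y -> x = y.
  move=> xy; apply/eqP; rewrite -subr_eq0; apply/eqP/nrm_eq0.
  have := Tlow (x - y); rewrite bopB xy subrr nrm0 => h.
  by apply/eqP; rewrite eq_le nrm_ge0 andbT -(pmulr_rle0 _ d0).
have [S SP] : exists S : bop H, forall x, S x = g x.
  apply: (@bop_build _ d^-1) => [a x y|x].
    by apply: Tinj; rewrite bopD bopZ !gP.
  by rewrite ler_pdivlMl//; apply: le_trans (Tlow _) _; rewrite gP.
exists S; split; apply: bopP => x.
  by apply: Tinj; rewrite /= SP gP.
by rewrite /= SP gP.
Qed.

(** Positivity of T at x - T x / N bounds |T x|^2 by N <T x, x>, and the inverse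
    of T bounds |x| by |T x|. *)
Lemma invertible_coercive T : positive_op T -> invertible_op T ->
  exists2 d : R, 0 < d & coercive d T.
Proof.
move=> /positive_opP[Tim Tpos] [S [ST _]].
have Tsym x y : ip (T x) y = ip x (T y) by rewrite /ip real_form_symmetric.
set N := opnorm T + 1; set K := opnorm S + 1.
have N0 : 0 < N by rewrite ltr_wpDl ?opnorm_ge0.
have K0 : 0 < K by rewrite ltr_wpDl ?opnorm_ge0.
have h1 x : nrm (T x) ^+ 2 <= N * ip (T x) x.
  (* The step N^-1, with N at least the norm of T, keeps the quadratic term
     at most half of the linear one. *)
  have := Tpos (x - (N^-1)%:C *: T x).
  rewrite bopB bopZ !ipBl !ipBr !ipZl !ipZr (Tsym (T x) x) -nrm_sqr.
  have := opnorm_ip T (T x) (T x); rewrite -mulrA -expr2.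
  set b := nrm _ ^+ 2; set c := ip (T (T x)) _; set a := ip _ x => h.
  have {h} : c <= N * b.
    apply: le_trans (ler_norm _) _; apply: le_trans h _.
    by rewrite ler_wpM2r ?sqr_ge0// lerDl.
  move=> h2 h3.
  have {h3} : 0 <= N ^+ 2 * (a - N^-1 * b - N^-1 * (b - N^-1 * c)).
    by rewrite mulr_ge0 ?sqr_ge0//; move: h3; congr (_ <= _); ring.
  have -> : N ^+ 2 * (a - N^-1 * b - N^-1 * (b - N^-1 * c)) = N * (N * a - b) + (c - N * b).
    by field; rewrite gt_eqF.
  move=> h3; rewrite -subr_ge0 -(pmulr_rge0 _ N0); lra.
have h2 x : nrm x <= K * nrm (T x).
  have -> : x = S (T x) by rewrite -[LHS]/((1 : bop H) x) -ST.
  apply: le_trans (opnormP _ _) _.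
  rewrite -[S (T x)]/((S * T) x) ST ler_wpM2r ?nrm_ge0// lerDl.
  by [].
exists (K ^+ 2 * N)^-1; first by rewrite invr_gt0 mulr_gt0 ?exprn_gt0.
move=> x; rewrite ler_pdivrMl ?mulr_gt0 ?exprn_gt0// -mulrA.
apply: le_trans (_ : K ^+ 2 * nrm (T x) ^+ 2 <= _).
  by rewrite -exprMn ler_sqr ?nnegrE ?mulr_ge0 ?nrm_ge0// ltW.
by rewrite ler_wpM2l ?sqr_ge0.
Qed.

Lemma opnormM S T : opnorm (S * T) <= opnorm S * opnorm T.
Proof.
apply: opnorm_le => x x1; apply: le_trans (opnormP S (T x)) _.
by rewrite ler_wpM2l ?opnorm_ge0// opnorm_ub.
Qed.

Lemma bop_sumE (I : Type) (r : seq I) (T : I -> bop H) (x : H) :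
  (\sum_(i <- r) T i) x = \sum_(i <- r) T i x.
Proof. by elim/big_rec2: _ => [//|i u w _ <-]. Qed.

Lemma inner_suml (I : Type) (r : seq I) (y : I -> H) (v : H) :
  inner (\sum_(i <- r) y i) v = \sum_(i <- r) inner (y i) v.
Proof. by elim/big_rec2: _ => [|i u w _ <-]; rewrite ?linear0l ?innerDl. Qed.

Lemma nrm_inner x y :
  nrm (inner x y : R[i]) <= nrm x * nrm y.
Proof.
set c := inner x y; have [->|c0] := eqVneq (nrm (c : R[i])) 0.
  by rewrite mulr_ge0 ?nrm_ge0.
have {}c0 : 0 < nrm (c : R[i]) by rewrite lt_neqAle eq_sym c0 nrm_ge0.
rewrite -(ler_pM2l c0) -expr2.
have -> : nrm (c : R[i]) ^+ 2 = ip x (c *: y).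
  apply: complexI; rewrite /ip innerZr -/c rmorphXn /= -nrmE.
  by rewrite normCKC RRe_real// -normCKC ger0_real// exprn_ge0.
by apply: le_trans (ip_le _ _) _; rewrite nrmZ mulrCA.
Qed.

Lemma opnormD (S T : bop H) : opnorm (S + T) <= opnorm S + opnorm T.
Proof. by rewrite -lecR rmorphD; exact: opnormC_triangle. Qed.

Lemma opnorm0 : opnorm (0 : bop H) = 0.
Proof.
apply/eqP; rewrite eq_le opnorm_ge0 andbT; apply: opnorm_le => x _.
by rewrite bop_zeroE nrm0.
Qed.

Lemma opnormZ (a : R[i]) (T : bop H) : opnorm (a *: T) = nrm (a : R[i]) * opnorm T.
Proof. by apply: complexI; rewrite rmorphM /= -nrmE; exact: opnormCZ. Qed.

Lemma coercive_perturb (S T : bop H) d e : coercive d T -> opnorm (S - T) <= e ->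
  coercive (d - e) S.
Proof.
move=> Td STe x; have -> : S x = T x + (S - T) x.
  by rewrite -[RHS]/((T + (S - T)) x) addrC subrK.
rewrite ipDl mulrBl; apply: lerD; first exact: Td.
have := opnorm_ip (S - T) x x; rewrite ler_norml => /andP[h _].
apply: le_trans h; rewrite lerN2 -mulrA -expr2.
by rewrite ler_wpM2r ?sqr_ge0.
Qed.

End Operators.

(** * Positive operators and conjugation by words *)

Section OperatorOrder.
Variables (R : realType) (H : hilbertType R).
Implicit Types (x y z : H) (S T : bop H).

Lemma bop_scaleAl (a : R[i]) S T : (a *: S) * T = a *: (S * T).
Proof. exact: bopP. Qed.
Lemma bop_scaleAr (a : R[i]) S T : S * (a *: T) = a *: (S * T).
Proof. by apply: bopP => x; rewrite bopM !bop_scaleE bopZ. Qed.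

Lemma positive_op0 : positive_op (0 : bop H).
Proof. by move=> x; rewrite bop_zeroE linear0l. Qed.

Lemma positive_opD S T : positive_op S -> positive_op T -> positive_op (S + T).
Proof. by move=> S0 T0 x; rewrite bop_addE innerDl addr_ge0. Qed.

Lemma positive_opZ (c : R) T : 0 <= c -> positive_op T -> positive_op (c%:C *: T).
Proof. by move=> c0 T0 x; rewrite bop_scaleE innerZl mulr_ge0// lecR. Qed.

Lemma positive_op_sum (I : Type) (r : seq I) (T : I -> bop H) :
  (forall i, positive_op (T i)) -> positive_op (\sum_(i <- r) T i).
Proof.
move=> T0; elim/big_ind: _ => //; [exact: positive_op0 | exact: positive_opD].
Qed.

Lemma inner_conj S T x :
  inner ((S * T * adjoint S) x) x = inner (T (adjoint S x)) (adjoint S x).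
Proof. by rewrite 2!bopM adjointP. Qed.

Lemma positive_op_conj S T : positive_op T -> positive_op (S * T * adjoint S).
Proof. by move=> T0 x; rewrite inner_conj. Qed.

Lemma real_form1 : real_form (1 : bop H).
Proof.
by move=> x; rewrite (_ : (1 : bop H) x = x)// -norm_inner nrmE -rmorphXn.
Qed.

Lemma real_formB S T : real_form S -> real_form T -> real_form (S - T).
Proof.
move=> S0 T0 x; rewrite (_ : (S - T) x = S x - T x)// innerBl.
by move: (S0 x) (T0 x); case: (inner _ _) => a b; case: (inner _ _) => c d /= -> ->; rewrite subr0.
Qed.

Lemma coercive_le S T d : positive_op (S - T) -> coercive d T -> coercive d S.
Proof.
move=> /positive_opP[_ ST] Td x; apply: le_trans (Td x) _.
have := ST x; rewrite [(S - T) x]bop_addE ipDl.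
have -> : (- T) x = - T x by [].
by rewrite -[- T x]sub0r ipBl /ip linear0l /= sub0r subr_ge0.
Qed.

End OperatorOrder.

Section WordMaps.
Variables (R : realType) (H : hilbertType R) (m : nat).
Implicit Types (X : 'I_m -> bop H) (Y Z : bop H) (c : seq 'I_m -> R).

(** [Phi] with arbitrary weights: scaling the tuple only rescales the weights, so
    that differences of such maps for proportional tuples have the same form. *)
Definition word_map c (s : seq (seq 'I_m)) X Y : bop H :=
  \sum_(w <- s) (c w)%:C *: (word_op X w * Y * adjoint (word_op X w)).

Lemma PhiE (q : ncpoly R m) X Y : Phi q X Y = word_map q (finsupp q) X Y.
Proof. by []. Qed.

Lemma word_mapD c s X Y Z : word_map c s X (Y + Z) = word_map c s X Y + word_map c s X Z.
Proof.
rewrite -big_split; apply: eq_bigr => w _.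
by rewrite mulrDr mulrDl scalerDr.
Qed.

Lemma word_mapB c s X Y Z : word_map c s X (Y - Z) = word_map c s X Y - word_map c s X Z.
Proof.
rewrite -sumrB; apply: eq_bigr => w _.
by rewrite mulrBr mulrBl scalerBr.
Qed.

Lemma word_mapZ c s X (a : R[i]) Y : word_map c s X (a *: Y) = a *: word_map c s X Y.
Proof.
rewrite scaler_sumr; apply: eq_bigr => w _.
by rewrite bop_scaleAr bop_scaleAl scalerA mulrC -scalerA.
Qed.

Lemma word_map_sum c s X (I : Type) (r : seq I) (Y : I -> bop H) :
  word_map c s X (\sum_(i <- r) Y i) = \sum_(i <- r) word_map c s X (Y i).
Proof.
elim: r => [|i r IH]; last by rewrite !big_cons word_mapD IH.
by rewrite !big_nil /word_map big1// => w _; rewrite mulr0 mul0r scaler0.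
Qed.

Lemma word_map_pos c s X Y : (forall w, 0 <= c w) -> positive_op Y ->
  positive_op (word_map c s X Y).
Proof.
move=> c0 Y0; apply: positive_op_sum => w.
by apply: positive_opZ => //; apply: positive_op_conj.
Qed.

Lemma word_map_real c s X Y : real_form Y ->
  real_form (word_map c s X Y).
Proof.
move=> Y0 x; rewrite /word_map; elim: s => [|w s IH].
  by rewrite big_nil bop_zeroE linear0l.
rewrite big_cons bop_addE innerDl Im_add IH bop_scaleE innerZl.
by rewrite Im_realM inner_conj Y0 mulr0 addr0.
Qed.

Lemma word_op_scale (a : R[i]) X w :
  word_op (fun j => a *: X j) w = a ^+ size w *: word_op X w.
Proof.
elim: w => [|j w IH]; rewrite /word_op ?big_nil ?scale1r// !big_cons.
rewrite -!/(word_op _ _) IH bop_scaleAr bop_scaleAl scalerA /=.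
by rewrite exprSr.
Qed.

Lemma Phi_scale (q : ncpoly R m) (a : R[i]) X Y :
  Phi q (fun j => a *: X j) Y =
  word_map (fun w => q w * nrm (a : R[i]) ^+ (2 * size w)) (finsupp q) X Y.
Proof.
apply: eq_bigr => w _; rewrite word_op_scale adjointZ.
rewrite !(bop_scaleAl, bop_scaleAr) !scalerA; congr (_ *: _).
rewrite -mulrA rmorphM; congr (_ * _).
have a2 : (nrm (a : R[i]) ^+ 2)%:C = a * a^*%R by rewrite -normCK nrmE -rmorphXn.
by rewrite exprM [RHS]rmorphXn /= a2 exprMn rmorphXn.
Qed.

End WordMaps.

Lemma word_op_comm (R : realType) (H : hilbertType R) (m l : nat)
    (X : 'I_m -> bop H) (X' : 'I_l -> bop H) :
  (forall i j, X i * X' j = X' j * X i) ->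
  forall w w', word_op X w * word_op X' w' = word_op X' w' * word_op X w.
Proof.
move=> XX' w w'; rewrite /word_op; apply: commr_prod => i _.
by apply/commr_sym/commr_prod => j _; apply/commr_sym/XX'.
Qed.

(** Adjoints reverse products, so that both sides conjugate by the same word. *)
Lemma word_map_comm (R : realType) (H : hilbertType R) (m l : nat)
    (X : 'I_m -> bop H) (X' : 'I_l -> bop H) c s c' s' Y :
  (forall i j, X i * X' j = X' j * X i) ->
  word_map c s X (word_map c' s' X' Y) = word_map c' s' X' (word_map c s X Y).
Proof.
move=> XX'; rewrite {2}/word_map word_map_sum [RHS]/word_map.
apply: eq_bigr => w' _; rewrite word_mapZ; congr (_ *: _).
rewrite /word_map mulr_sumr mulr_suml; apply: eq_bigr => w _.
rewrite bop_scaleAr bop_scaleAl; congr (_ *: _).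
rewrite !mulrA word_op_comm// -!mulrA -!adjointM.
by rewrite word_op_comm.
Qed.

(** * Comparing products of commuting maps *)

Section Domination.
Variables (R : realType) (H : hilbertType R) (I : eqType).
Variables (D P : I -> bop H -> bop H).
Hypothesis DD : forall i, {morph D i : Y Z / Y + Z}.
Hypothesis DP : forall i j, i != j -> forall Y, D i (P j Y) = P j (D i Y).
Hypothesis Ppos : forall i Y, positive_op Y -> positive_op (P i Y).

Let Dfold (p : I -> bool) Y t := foldr (fun i Z => iter (p i) (D i) Z) Y t.
Let Efold s := foldr (fun i Z => D i Z + P i Z) 1 s.

Let DfoldD p Y Z t : Dfold p (Y + Z) t = Dfold p Y t + Dfold p Z t.
Proof. by elim: t => //= i t ->; case: (p i) => //=; rewrite DD. Qed.

Let DfoldP p a Y t : a \notin t -> Dfold p (P a Y) t = P a (Dfold p Y t).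
Proof.
elim: t => //= i t IH; rewrite inE negb_or => /andP[ai at_].
by rewrite IH//; case: (p i) => //=; rewrite DP// eq_sym.
Qed.

Let eq_Dfold p p' Y t : {in t, p =1 p'} -> Dfold p Y t = Dfold p' Y t.
Proof.
elim: t => //= i t IH pp'; rewrite pp' ?mem_head// IH// => j jt.
by rewrite pp'// inE jt orbT.
Qed.

(** The factors D_i are replaced by D_i + P_i one at a time from the inside; t
    lists the factors still of the form D_i^p_i.  Splitting the outermost
    replaced factor, D_a joins t and P_a commutes out through t, where it acts
    on the same product with the exponent of a set to 0. *)
Lemma fold_domination t s (p : I -> bool) : uniq (t ++ s) ->
  (forall p' : I -> bool, positive_op (foldr (fun i Z => iter (p' i) (D i) Z) 1 (t ++ s))) ->
  {in s, forall i, p i} ->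
  positive_op (foldr (fun i Z => iter (p i) (D i) Z)
                 (foldr (fun i Z => D i Z + P i Z) 1 s) t -
               foldr (fun i Z => iter (p i) (D i) Z) 1 (t ++ s)).
Proof.
elim: s t p => [|a s IH] t p u pos ps.
  by rewrite cats0 subrr; exact: positive_op0.
rewrite -!/(Dfold _ _ _) -!/(Efold _) /=.
have at_ : a \notin t.
  by move: u; rewrite cat_uniq /= negb_or => /and3P[_ /andP[]].
have as_ : a \notin s.
  by move: u; rewrite cat_uniq /= => /and3P[_ _ /andP[]].
rewrite -cat_rcons in u pos *.
have ps' : {in s, forall i, p i} by move=> i is_; rewrite ps// inE is_ orbT.
rewrite DfoldD DfoldP//.
have -> : Dfold p (D a (Efold s)) t = Dfold p (Efold s) (rcons t a).
  by rewrite /Dfold foldr_rcons ps// mem_head.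
rewrite addrAC; apply: positive_opD; first exact: IH.
apply: Ppos.
pose p' i := (i != a) && p i.
have -> : Dfold p (Efold s) t = Dfold p' (Efold s) (rcons t a).
  rewrite /Dfold foldr_rcons /p' eqxx /=; apply: eq_Dfold => i it.
  by case: eqVneq it at_ => // -> ->.
rewrite -[X in positive_op X](subrK (Dfold p' 1 (rcons t a ++ s))).
apply: positive_opD; last exact: pos.
apply: IH => // i is_; rewrite /p' ps'// andbT.
by case: eqVneq is_ as_ => // -> ->.
Qed.

End Domination.

(** * The polydomain is circular, starlike and relatively open *)

Section LipschitzPaths.
Variables (R : realType) (H : hilbertType R) (t0 : R).
Implicit Types (g h : R -> bop H).

(** A quantitative continuity at one point, stable under the operations that
    build the defect of a scaled tuple. *)
Definition lipschitz_at g := exists2 M : R, 0 <= M &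
  forall t, `|t - t0| <= 1 -> opnorm (g t - g t0) <= M * `|t - t0|.

Lemma lipschitz_cst (T : bop H) : lipschitz_at (fun=> T).
Proof. by exists 0 => // t _; rewrite subrr opnorm0 mul0r. Qed.

Lemma lipschitzD g h : lipschitz_at g -> lipschitz_at h ->
  lipschitz_at (fun t => g t + h t).
Proof.
move=> [M M0 gM] [N N0 hN]; exists (M + N); first exact: addr_ge0.
move=> t tt0; rewrite opprD addrACA mulrDl; apply: le_trans (opnormD _ _) _.
by apply: lerD; [exact: gM | exact: hN].
Qed.

Lemma lipschitzZ (a : R[i]) g : lipschitz_at g -> lipschitz_at (fun t => a *: g t).
Proof.
move=> [M M0 gM]; exists (nrm (a : R[i]) * M); first by rewrite mulr_ge0 ?nrm_ge0.
by move=> t tt0; rewrite -scalerBr opnormZ -mulrA ler_wpM2l ?nrm_ge0// gM.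
Qed.

Lemma lipschitzB g h : lipschitz_at g -> lipschitz_at h ->
  lipschitz_at (fun t => g t - h t).
Proof.
move=> lg lh; have := lipschitzD lg (lipschitzZ (-1) lh).
by congr lipschitz_at; apply/funext => t; rewrite scaleN1r.
Qed.

Lemma lipschitz_mul (A B : bop H) g : lipschitz_at g ->
  lipschitz_at (fun t => A * g t * B).
Proof.
move=> [M M0 gM]; exists (opnorm A * M * opnorm B).
  by rewrite !mulr_ge0 ?opnorm_ge0.
move=> t tt0; rewrite -mulrBl -mulrBr; apply: le_trans (opnormM _ _) _.
rewrite [leRHS]mulrAC ler_wpM2r ?opnorm_ge0//; apply: le_trans (opnormM _ _) _.
by rewrite -mulrA ler_wpM2l ?opnorm_ge0// gM.
Qed.

Lemma lipschitz_abs g : lipschitz_at g -> lipschitz_at (fun t => `|t|%:C *: g t).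
Proof.
move=> [M M0 gM]; exists ((`|t0| + 1) * M + opnorm (g t0)).
  by rewrite addr_ge0 ?opnorm_ge0// mulr_ge0// addr_ge0.
move=> t tt0.
have -> : `|t|%:C *: g t - `|t0|%:C *: g t0 =
    `|t|%:C *: (g t - g t0) + (`|t| - `|t0|)%:C *: g t0.
  by rewrite scalerBr rmorphB scalerBl addrA subrK.
apply: le_trans (opnormD _ _) _; rewrite !opnormZ !nrm_real normr_id mulrDl.
apply: lerD; last by rewrite mulrC ler_wpM2l ?opnorm_ge0// ler_dist_dist.
rewrite -mulrA ler_pM ?opnorm_ge0//; last exact: gM.
by rewrite -[t](subrK t0) addrC; apply: le_trans (ler_normD _ _) _; rewrite lerD2l.
Qed.

Lemma lipschitz_pow g n : lipschitz_at g ->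
  lipschitz_at (fun t => (`|t| ^+ n)%:C *: g t).
Proof.
move=> lg; elim: n => [|n /lipschitz_abs IH].
  by congr lipschitz_at: lg; apply/funext => t; rewrite expr0 scale1r.
by congr lipschitz_at: IH; apply/funext => t; rewrite scalerA -rmorphM -exprS.
Qed.

Lemma lipschitz_sum (I : Type) (r : seq I) (g : I -> R -> bop H) :
  (forall i, lipschitz_at (g i)) -> lipschitz_at (fun t => \sum_(i <- r) g i t).
Proof.
move=> lg; elim: r => [|i r IH].
  by have := lipschitz_cst 0; congr lipschitz_at; apply/funext => t; rewrite big_nil.
have := lipschitzD (lg i) IH.
by congr lipschitz_at; apply/funext => t; rewrite big_cons.
Qed.

Lemma lipschitz_Phi m (q : ncpoly R m) (X : 'I_m -> bop H) g : lipschitz_at g ->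
  lipschitz_at (fun t => Phi q (fun j => t%:C *: X j) (g t)).
Proof.
move=> lg; have := @lipschitz_sum _ (finsupp q) (fun w t => (q w)%:C *:
  ((`|t| ^+ (2 * size w))%:C *: (word_op X w * g t * adjoint (word_op X w)))).
have -> : (fun t => Phi q (fun j => t%:C *: X j) (g t)) =
   (fun t => \sum_(w <- finsupp q) (q w)%:C *:
  ((`|t| ^+ (2 * size w))%:C *: (word_op X w * g t * adjoint (word_op X w)))).
  apply/funext => t; rewrite Phi_scale; apply: eq_bigr => w _.
  by rewrite nrm_real rmorphM scalerA.
by apply=> w; apply/lipschitzZ/lipschitz_pow/lipschitz_mul.
Qed.

End LipschitzPaths.

Section Polydomains.
Variables (R : realType) (H : hilbertType R) (k : nat) (n : 'I_k -> nat).
Variable q : forall i : 'I_k, ncpoly R (n i).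
Implicit Types (X : optuple n H) (p : 'I_k -> bool).

Definition cscale (a : R[i]) X : optuple n H := fun i j => a *: X i j.
Arguments cscale a X i j : clear implicits.

Lemma cscale_comp a b X : cscale a (cscale b X) = cscale (a * b) X.
Proof. by apply/functional_extensionality_dep => i; apply/funext => j; rewrite /cscale scalerA. Qed.

Lemma cscale1 X : cscale 1 X = X.
Proof. by apply/functional_extensionality_dep => i; apply/funext => j; rewrite /cscale scale1r. Qed.

Lemma cross_commuting_cscale a X : cross_commuting X -> cross_commuting (cscale a X).
Proof.
move=> XX s t st j l; rewrite /cscale !bop_scaleAl !bop_scaleAr XX// scalerA mulrC -scalerA.
Qed.

Lemma defectE X p Y : defect q X p Y =
  foldr (fun i Z => iter (p i) (fun Y => Y - Phi (q i) (X i) Y) Z) Y (index_enum 'I_k).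
Proof.
rewrite /defect; elim: (index_enum _) => [|i r IH]; first by rewrite big_nil.
by rewrite big_cons /= IH.
Qed.

Lemma defect_real X p : real_form (defect q X p 1).
Proof.
rewrite defectE; elim: (index_enum _) => [|i r IH] /=; first exact: real_form1.
case: (p i) => //=; apply: real_formB => //; exact: word_map_real.
Qed.

Lemma polydomain_coercive X d : 0 < d -> cross_commuting X ->
  (forall p, coercive d (defect q X p 1)) -> polydomain q X.
Proof.
move=> d0 XX co.
have pos p : positive_op (defect q X p 1).
  apply/positive_opP; split; first exact: defect_real.
  by move=> x; apply: le_trans (co p x); rewrite mulr_ge0 ?sqr_ge0// ltW.
split=> //; apply: (coercive_invertible d0) => // x; exact: defect_real.
Qed.

Hypothesis qreg : forall i, positive_regular (q i).

Lemma Phi_commute X i j Y : cross_commuting X -> i != j ->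
  forall c c' s s', word_map c s (X i) (word_map c' s' (X j) Y) =
    word_map c' s' (X j) (word_map c s (X i) Y).
Proof. by move=> XX ij c c' s s'; apply: word_map_comm => l m; exact: XX. Qed.

(** The factor id - Phi_i of X becomes that of a X when p_i = 1 and the identity
    when p_i = 0; either way a positive map is added to it. *)
Lemma defect_domination X (a : R[i]) p : closed_polydomain q X -> `|a| <= 1 ->
  positive_op (defect q (cscale a X) p 1 - defect q X xpredT 1).
Proof.
move=> [XX pos] a1.
have na1 : nrm (a : R[i]) <= 1 by rewrite -lecR -nrmE.
pose D i Y := Y - Phi (q i) (X i) Y.
pose c i w := if p i then q i w * (1 - nrm (a : R[i]) ^+ (2 * size w)) else q i w.
pose P i Y := word_map (c i) (finsupp (q i)) (X i) Y.
have c0 i w : 0 <= c i w.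
  have [q0 _ _] := qreg i; rewrite /c; case: (p i) => //.
  by rewrite mulr_ge0// subr_ge0 exprn_ile1// nrm_ge0.
have DPE i Y : D i Y + P i Y = iter (p i) (fun Y => Y - Phi (q i) (cscale a X i) Y) Y.
  rewrite /D /P PhiE; have -> : word_map (c i) (finsupp (q i)) (X i) Y =
      word_map (q i) (finsupp (q i)) (X i) Y -
      (if p i then Phi (q i) (cscale a X i) Y else 0).
    rewrite /c; case: (p i); last by rewrite subr0.
    rewrite /cscale Phi_scale -sumrB; apply: eq_bigr => w _.
    by rewrite -scalerBl -rmorphB mulrBr mulr1.
  by rewrite addrA subrK; case: (p i) => //=; rewrite subr0.
have := @fold_domination R H _ D P _ _ _ [::] (index_enum 'I_k) xpredT.
rewrite !defectE /= => h.
have -> : (fun i Z => iter (p i) (fun Y => Y - Phi (q i) (cscale a X i) Y) Z) =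
   (fun i Z => D i Z + P i Z) by apply/funext => i; apply/funext => Z; rewrite DPE.
apply: h => //.
- by move=> i Y Z; rewrite /D !PhiE word_mapD opprD addrACA.
- by move=> i j ij Y; rewrite /D /P !PhiE word_mapB Phi_commute.
- by move=> i Y Y0; apply: word_map_pos.
- exact: index_enum_uniq.
- by move=> p'; have := pos p'; rewrite defectE.
Qed.

Lemma polydomain_gap X : polydomain q X -> exists2 d : R, 0 < d &
  forall a : R[i], `|a| <= 1 -> forall p, coercive d (defect q (cscale a X) p 1).
Proof.
move=> [Xc Xp Xi]; have [d d0 dX] := invertible_coercive Xp Xi.
exists d => // a a1 p; apply: coercive_le dX; exact: defect_domination.
Qed.

Lemma polydomain_cscale X (a : R[i]) : polydomain q X -> `|a| <= 1 ->
  polydomain q (cscale a X).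
Proof.
move=> XD a1; have [d d0 dX] := polydomain_gap XD.
apply: (polydomain_coercive d0); last exact: dX.
by case: XD => [[XX _] _ _]; exact: cross_commuting_cscale.
Qed.

Lemma lipschitz_defect t0 X p : lipschitz_at t0 (fun t => defect q (cscale t%:C X) p 1).
Proof.
have -> : (fun t => defect q (cscale t%:C X) p 1) = fun t =>
   foldr (fun i Z => iter (p i) (fun Y => Y - Phi (q i) (cscale t%:C X i) Y) Z)
      1 (index_enum 'I_k) by apply/funext => t; rewrite defectE.
elim: (index_enum _) => [|i r IH] /=; first exact: lipschitz_cst.
case: (p i) => //=; apply: lipschitzB => //; exact: lipschitz_Phi.
Qed.

(** There are finitely many exponents p, so that one Lipschitz constant and one
    radius serve for all of them. *)
Lemma polydomain_open t0 d X : 0 < d -> cross_commuting X ->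
  (forall p, coercive d (defect q (cscale t0%:C X) p 1)) ->
  exists2 e : R, 0 < e & forall t, `|t - t0| <= e -> polydomain q (cscale t%:C X).
Proof.
move=> d0 XX co.
have /choice[M MP] : forall f : {ffun 'I_k -> bool}, exists M : R, 0 <= M /\
   forall t, `|t - t0| <= 1 -> opnorm (defect q (cscale t%:C X) f 1 -
     defect q (cscale t0%:C X) f 1) <= M * `|t - t0|.
  by move=> f; have [M M0 MP] := lipschitz_defect t0 X f; exists M.
pose N := \sum_f M f + 1.
have N0 : 0 < N by rewrite ltr_wpDl// sumr_ge0// => f _; have [] := MP f.
have MN f : M f <= N.
  rewrite /N (bigD1 f)//= -addrA lerDl addr_ge0// sumr_ge0// => g _.
  by have [] := MP g.
exists (Num.min 1 (d / 2 / N)); first by rewrite lt_min ltr01 !divr_gt0.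
move=> t; rewrite le_min => /andP[t1 tN].
have d20 : 0 < d / 2 by rewrite divr_gt0.
apply: (polydomain_coercive d20); first exact: cross_commuting_cscale.
move=> p; pose f := [ffun i => p i].
have -> : p = f by apply/funext => i; rewrite ffunE.
have -> : d / 2 = d - d / 2 by lra.
apply: coercive_perturb (co f) _.
have [M0 h] := MP f; apply: le_trans (h t t1) _.
apply: le_trans (_ : N * `|t - t0| <= _); first by rewrite ler_wpM2r.
by rewrite mulrC -ler_pdivlMr.
Qed.

(** The lower bound of the defects at X itself allows X to be enlarged. *)
Lemma minkowski_lt1 X : polydomain q X -> minkowski q X < 1.
Proof.
move=> XD; have [d d0 dX] := polydomain_gap XD.
have [XX _] : closed_polydomain q X by case: XD.
have d1 p : coercive d (defect q (cscale 1%:C X) p 1) by apply: dX; rewrite normr1.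
have [e e0 eP] := polydomain_open d0 XX d1.
have e1 : 0 < 1 + e by rewrite addr_gt0.
apply: le_lt_trans (_ : (1 + e)^-1 < 1); last by rewrite invf_lt1// ltrDl.
apply: ge_inf; first by exists 0 => r [/ltW].
split; first by rewrite invr_gt0.
exists (cscale (1 + e)%:C X); first by apply: eP; rewrite addrC addKr gtr0_norm.
rewrite [LHS](cscale_comp (1 + e)^-1%:C (1 + e)%:C X).
by rewrite -rmorphM mulVf ?gt_eqF// cscale1.
Qed.

Lemma defect0 X p : defect q (cscale 0 X) p 1 = 1.
Proof.
rewrite defectE; elim: (index_enum _) => //= i r ->; case: (p i) => //=.
rewrite [X in _ - X](_ : _ = 0) ?subr0//.
rewrite Phi_scale; apply: big1_seq => w _.
have [_ q0 _] := qreg i.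
case: w => [|j w]; first by rewrite q0 mul0r scale0r.
by rewrite mulnS nrm0 expr0n mulr0 scale0r.
Qed.

(** The zero tuple has the identity as all its defects. *)
Lemma small_polydomain X : cross_commuting X ->
  exists2 t : R, 0 < t & polydomain q (cscale t%:C X).
Proof.
move=> XX; have d1 p : coercive 1 (defect q (cscale 0%:C X) p 1).
  by rewrite defect0 => x; rewrite mul1r nrm_sqr.
have [e e0 eP] := polydomain_open ltr01 XX d1.
by exists e => //; apply: eP; rewrite subr0 gtr0_norm.
Qed.

End Polydomains.
Arguments cscale {R H k n} a X i j.

(** * The maximum modulus principle for polynomials *)

Section MaximumModulus.
Variable R : realType.
Implicit Types (p : {poly R[i]}) (z w : R[i]) (K : R).

Lemma prim_root_exists N : (0 < N)%N -> exists w : R[i], N.-primitive_root w.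
Proof.
move=> N0; pose p : {poly R[i]} := 'X^N - 1.
have [r Dp] := closed_field_poly_normal p.
rewrite (monicP _) ?monicXnsubC // scale1r in Dp.
have rN1 : all N.-unity_root r by apply/allP=> z; rewrite -root_prod_XsubC -Dp.
have sz_r : (N < (size r).+1)%N by rewrite -(size_prod_XsubC r id) -Dp size_XnsubC.
have [|z _ zP] := hasP (cyclic.has_prim_root N0 rN1 _ sz_r); last by exists z.
by rewrite -separable.separable_prod_XsubC -Dp cyclotomic.separable_Xn_sub_1 // pnatr_eq0 -lt0n.
Qed.

Lemma prim_root_nrm N w : (0 < N)%N -> N.-primitive_root w -> nrm (w : R[i]) = 1.
Proof.
move=> N0 wP; apply/eqP; rewrite -(pexpr_eq1 N0) ?nrm_ge0//.
by rewrite -nrmX (prim_expr_order wP) /nrm normr1.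
Qed.

Lemma prim_root_sum N w (l m : nat) : (l < N)%N -> (m < N)%N -> N.-primitive_root w ->
  \sum_(j < N) (w ^+ j) ^+ (l + (N - m)) = (N * (l == m))%:R.
Proof.
move=> lN mN wP; pose e := (l + (N - m))%N.
under eq_bigr => j _ do rewrite -exprM mulnC exprM.
rewrite -/e; have [lm|lm] := eqVneq l m.
  have -> : w ^+ e = 1.
    by rewrite /e lm subnKC ?(ltnW mN)// (prim_expr_order wP).
  rewrite (eq_bigr (fun=> 1)) => [|j _]; last by rewrite expr1n.
  by rewrite sumr_const card_ord muln1.
rewrite muln0; have e1 : w ^+ e - 1 != 0.
  rewrite subr_eq0 -[1](prim_expr_order wP) (eq_prim_root_expr wP).
  rewrite -(eqn_modDr m) /e -addnA subnK ?(ltnW mN)//.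
  by rewrite modnDr modnDl !modn_small.
apply/(mulfI e1); rewrite mulr0 -subrX1 -exprM mulnC exprM (prim_expr_order wP).
by rewrite expr1n subrr.
Qed.

(** Averaging against the powers of a primitive root of unity of large order
    isolates a coefficient, so that no integral is needed. *)
Lemma coef_bound p K : (forall z, nrm (z : R[i]) = 1 -> nrm (p.[z] : R[i]) <= K) ->
  forall m, nrm (p`_m : R[i]) <= K.
Proof.
move=> pK m; set N := (maxn (size p) m).+1.
have N0 : (0 < N)%N by [].
have [w wP] := prim_root_exists N0.
have w1 j : nrm (w ^+ j : R[i]) = 1 by rewrite nrmX (prim_root_nrm N0 wP) expr1n.
have mN : (m < N)%N by rewrite ltnS leq_maxr.
have pN : (size p <= N)%N by rewrite leqW// leq_maxl.
have avg : \sum_(j < N) (w ^+ j) ^+ (N - m) * p.[w ^+ j] = N%:R * p`_m.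
  under eq_bigr => j _ do rewrite (horner_coef_wide _ pN) mulr_sumr.
  rewrite exchange_big /= (bigD1 (Ordinal mN))//= [X in _ + X]big1 ?addr0.
    under eq_bigr => j _ do rewrite mulrCA -exprD addnC.
    by rewrite -mulr_sumr prim_root_sum// eqxx muln1 mulrC.
  move=> l lm; under eq_bigr => j _ do rewrite mulrCA -exprD addnC.
  rewrite -mulr_sumr prim_root_sum//.
  have /negPf -> : (l : nat) != m by apply: contra lm => /eqP lm; apply/eqP/val_inj.
  by rewrite muln0 mulr0.
have NR0 : 0 < N%:R :> R by rewrite ltr0n.
rewrite -(ler_pM2l NR0).
have -> : N%:R * nrm (p`_m : R[i]) = nrm (N%:R * p`_m : R[i]).
  rewrite nrmM; congr (_ * _); apply: complexI.
  by rewrite -nrmE normr_nat rmorph_nat.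
rewrite -avg; apply: le_trans (nrm_sum _ _ _) _.
apply: le_trans (_ : \sum_(j < N) K <= _).
  by apply: ler_sum => j _; rewrite nrmM nrmX w1 expr1n mul1r pK.
by rewrite sumr_const card_ord mulr_natl.
Qed.

Lemma bernoulli_le (s : R) m : 0 <= s -> 1 + m%:R * s <= (1 + s) ^+ m.
Proof.
move=> s0; elim: m => [|m IH]; first by rewrite mul0r addr0 expr0.
rewrite exprS; apply: le_trans (_ : (1 + s) * (1 + m%:R * s) <= _); last first.
  by rewrite ler_wpM2l// addr_ge0.
have : 0 <= s * (m%:R * s) by rewrite !mulr_ge0.
rewrite -natr1; nra.
Qed.

(** If x > K then (x / K)^m grows quadratically in m along even exponents, by
    squaring the Bernoulli inequality. *)
Lemma power_trick (x K : R) (d : nat) : 0 <= x -> 0 <= K ->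
  (forall m, x ^+ m <= (d * m).+1%:R * K ^+ m) -> x <= K.
Proof.
move=> x0 K0 xK; rewrite leNgt; apply/negP => Kx.
have [K00|K00] := eqVneq K 0.
  by have := xK 1%N; rewrite !expr1 K00 mulr0 leNgt -K00 Kx.
have {K00}K0 : 0 < K by rewrite lt_neqAle eq_sym K00.
pose s := x / K - 1.
have s0 : 0 < s by rewrite subr_gt0 ltr_pdivlMr ?mul1r.
have sm m : (1 + s) ^+ m <= (d * m).+1%:R.
  by rewrite /s addrC subrK expr_div_n ler_pdivrMr ?exprn_gt0.
clearbody s.
(* Beyond this m the square (m s)^2 exceeds 2 d m + 1. *)
pose m := (Num.truncn ((d.*2).+1%:R / s ^+ 2)).+1.
have mP : (d.*2).+1%:R / s ^+ 2 < m%:R by rewrite truncnS_gt.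
have m1 : 1 <= m%:R :> R by rewrite ler1n.
have := sm (m + m)%N; apply/negP; rewrite -ltNge.
have h1 := bernoulli_le m (ltW s0).
have s0' := ltW s0; have : (m%:R * s) ^+ 2 <= (1 + s) ^+ (m + m).
  rewrite exprD -expr2 ler_sqr ?nnegrE ?mulr_ge0 ?exprn_ge0 ?addr_ge0//.
  by apply: le_trans h1; rewrite lerDr.
move=> h2; apply: lt_le_trans h2; rewrite exprMn.
move: mP; rewrite ltr_pdivrMr ?exprn_gt0// => mP.
apply: le_lt_trans (_ : m%:R * (d.*2).+1%:R < _).
  by rewrite -natrM ler_nat; have : (0 < m)%N by []; lia.
by rewrite [X in X * _ ^+ _]expr2 -mulrA ltr_pM2l// ltr0n.
Qed.

(** The coefficients of p ^+ m are bounded by K ^+ m, so that |p(z)| ^ m is at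
    most K ^ m times a quantity linear in m, which disappears in the m-th root. *)
Lemma maximum_modulus p K : (forall z, nrm (z : R[i]) = 1 -> nrm (p.[z] : R[i]) <= K) ->
  forall z, nrm (z : R[i]) <= 1 -> nrm (p.[z] : R[i]) <= K.
Proof.
move=> pK z z1.
have K0 : 0 <= K.
  by apply: le_trans (pK 1 _); rewrite ?nrm_ge0// /nrm normr1.
apply: (@power_trick _ _ (size p).-1); rewrite ?nrm_ge0// => m.
rewrite -nrmX -horner_exp horner_coef.
apply: le_trans (nrm_sum _ _ _) _.
apply: le_trans (_ : \sum_(i < size (p ^+ m)) K ^+ m <= _).
  apply: ler_sum => i _; rewrite nrmM -[leRHS]mulr1.
  apply: ler_pM; rewrite ?nrm_ge0//; last by rewrite nrmX exprn_ile1// nrm_ge0.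
  apply: coef_bound => w w1; rewrite horner_exp nrmX.
  by rewrite lerXn2r ?nnegrE ?nrm_ge0// pK.
rewrite sumr_const card_ord -[leLHS]mulr_natl ler_wpM2r ?exprn_ge0// ler_nat.
exact: size_exp_leq.
Qed.

End MaximumModulus.

(** * Unordered power series and their Schwarz lemma *)

#[local] Existing Instance totally_filter.

Section UnorderedSums.
Variable R : realType.

Lemma partial_sumE (I : choiceType) (V : zmodType) (a : I -> V) (A : {fset I}) :
  partial_sum a A = \sum_(i <- A) a i.
Proof. by rewrite big_seq_fsetE. Qed.

Lemma sum_fsetD (I : choiceType) (V : zmodType) (a : I -> V) (A B : {fset I}) :
  A `<=` B -> \sum_(i <- B) a i = \sum_(i <- A) a i + \sum_(i <- B `\` A) a i.
Proof.
move=> /fsubsetP AB; rewrite (big_fsetID _ (mem A))/=; congr (_ + _).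
  apply: eq_fbigl => i; rewrite !inE /=.
  by case: (boolP (i \in A)) => iA; rewrite ?andbF// andbT AB.
by apply: eq_fbigl => i; rewrite !inE /= andbC.
Qed.

Lemma partial_sum_cvgP (V : normedModType R[i]) (I : choiceType) (a : I -> V) (l : V) :
  partial_sum a @ totally --> l <->
  forall e : R, 0 < e -> exists J : {fset I}, forall A : {fset I}, J `<=` A ->
    nrm (l - \sum_(i <- A) a i) < e.
Proof.
rewrite cvg_nrmP; split=> h e e0.
  have [J _ JP] := h e e0; exists J => A JA; rewrite -partial_sumE; exact: JP.
by have [J JP] := h e e0; exists J => // A JA; rewrite /= partial_sumE; exact: JP.
Qed.

Lemma summable_tail (V : normedModType R[i]) (I : choiceType) (a : I -> V) :
  cvg (partial_sum a @ totally) -> forall e : R, 0 < e ->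
  exists J : {fset I}, forall A : {fset I}, [disjoint A & J] ->
    nrm (\sum_(i <- A) a i) <= e.
Proof.
move=> /cvg_ex[l al] e e0; have la := iffLR (partial_sum_cvgP _ _) al.
have e20 : 0 < e / 2 by rewrite divr_gt0.
have [J JP] := la _ e20.
exists J => A AJ.
have -> : \sum_(i <- A) a i =
    (l - \sum_(i <- J) a i) - (l - \sum_(i <- J `|` A) a i).
  rewrite (@sum_fsetD _ _ a J (J `|` A)) ?fsubsetUl//.
  have -> : (J `|` A) `\` J = A.
    by rewrite fsetDUl fsetDv fset0U; apply/fsetDidPl.
  by rewrite opprB addrC addrA subrK addrC addKr.
apply: le_trans (nrm_add _ _) _; rewrite nrm_opp [leRHS]splitr; apply: lerD.
  by apply: ltW; apply: JP; exact: fsubset_refl.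
by apply: ltW; apply: JP; exact: fsubsetUl.
Qed.

(** The terms of each sign form a subfamily without cancellation. *)
Lemma sum_abs_bound (I : choiceType) (b : I -> R) (A : {fset I}) (e : R) :
  (forall B : {fset I}, B `<=` A -> `|\sum_(i <- B) b i| <= e) ->
  \sum_(i <- A) `|b i| <= e + e.
Proof.
move=> be; rewrite (big_fsetID _ (fun i => 0 <= b i))/=; apply: lerD.
  rewrite (eq_fbigr _ (G := b)); last first.
    by move=> i; rewrite !inE /= => /andP[_ b0] _; rewrite ger0_norm.
  apply: le_trans (ler_norm _) _; apply: be.
  by apply/fsubsetP => i; rewrite !inE => /andP[].
rewrite (eq_fbigr _ (G := fun i => - b i)); last first.
  by move=> i; rewrite !inE /= -ltNge => /andP[_ b0] _; rewrite ltr0_norm.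
rewrite sumrN; apply: le_trans (ler_norm _) _; rewrite normrN; apply: be.
by apply/fsubsetP => i; rewrite !inE => /andP[].
Qed.

(** Unordered summability of scalars is absolute: real and imaginary parts of a
    given sign cannot cancel. *)
Lemma summable_abs_tail (I : choiceType) (a : I -> R[i]) :
  cvg (partial_sum a @ totally) -> forall e : R, 0 < e ->
  exists J : {fset I}, forall A : {fset I}, [disjoint A & J] ->
    \sum_(i <- A) nrm (a i : R[i]) <= e.
Proof.
move=> ca e e0.
have e40 : 0 < e / 4 by rewrite divr_gt0.
have [J JP] := summable_tail ca e40; exists J => A AJ.
apply: le_trans (_ : \sum_(i <- A) (`|complex.Re (a i)| + `|complex.Im (a i)|) <= _).
  by apply: ler_sum => i _; exact: nrm_Re_Im.
have sub (B : {fset I}) : B `<=` A -> nrm (\sum_(i <- B) a i : R[i]) <= e / 4.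
  by move=> BA; apply: JP; apply: fdisjointWl BA AJ.
rewrite big_split /= (_ : e = (e / 4 + e / 4) + (e / 4 + e / 4)); last by lra.
apply: lerD; apply: sum_abs_bound => B BA; apply: le_trans (sub _ BA).
  by rewrite -raddf_sum -lecR -nrmE le_Re_norm.
by rewrite -raddf_sum -lecR -nrmE le_Im_norm.
Qed.

Lemma limit_bound (V : normedModType R[i]) (I : choiceType) (a : I -> V)
    (s x : V) (M : R) (A : {fset I}) :
  partial_sum a @ totally --> s ->
  (forall B : {fset I}, A `<=` B -> nrm (\sum_(i <- B) a i - x) <= M) ->
  nrm (s - x) <= M.
Proof.
move=> sa AM; apply/ler_addgt0Pr => e e0.
have [J JP] := iffLR (partial_sum_cvgP _ _) sa _ e0.
rewrite -(subrK (\sum_(i <- J `|` A) a i) s) -addrA addrC.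
apply: le_trans (nrm_add _ _) _; apply: lerD; first by apply: AM; exact: fsubsetUr.
by apply/ltW/JP; exact: fsubsetUl.
Qed.

End UnorderedSums.

Section Schwarz.
Variables (R : realType) (I : choiceType) (d : I -> nat) (a : I -> R[i]).
Variable S : R[i] -> R[i].
Hypothesis a0 : forall i, d i = 0%N -> a i = 0.
Hypothesis Sa : forall z, nrm (z : R[i]) <= 1 ->
  partial_sum (fun i => z ^+ d i * a i) @ totally --> S z.

Let nrm1 : nrm (1 : R[i]) = 1. Proof. by rewrite /nrm normr1. Qed.

Let cvg_a : cvg (partial_sum a @ totally).
Proof.
have -> : a = fun i => 1 ^+ d i * a i by apply/funext => i; rewrite expr1n mul1r.
by apply/cvg_ex; exists (S 1); apply: Sa; rewrite nrm1.
Qed.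

(** Absolute summability makes the convergence uniform on the closed disc. *)
Let approx (e : R) : 0 < e -> exists J : {fset I}, forall A : {fset I}, J `<=` A ->
  forall z, nrm (z : R[i]) <= 1 -> nrm (S z - \sum_(i <- A) z ^+ d i * a i) <= e.
Proof.
move=> e0; have [J JP] := summable_abs_tail cvg_a e0; exists J => A JA z z1.
apply: (limit_bound (A := A) (Sa z1)) => B AB.
rewrite (sum_fsetD _ AB) addrC addKr; apply: le_trans (nrm_sum _ _ _) _.
apply: le_trans (JP (B `\` A) _).
  by apply: ler_sum => i _; rewrite nrmM nrmX ler_piMl ?nrm_ge0// exprn_ile1// nrm_ge0.
apply/fdisjointP => i; rewrite inE => /andP[iA _]; apply: contra iA.
exact: (fsubsetP JA).
Qed.

(** The partial sums divided by z. *)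
Let quot (A : {fset I}) : {poly R[i]} := \sum_(i <- A) a i *: 'X^((d i).-1).

Let quotE A z : z * (quot A).[z] = \sum_(i <- A) z ^+ d i * a i.
Proof.
rewrite /quot horner_sum mulr_sumr; apply: eq_bigr => i _.
rewrite hornerZ hornerXn; case E: (d i) => [|m] /=; first by rewrite a0// mul0r !mulr0.
by rewrite exprS mulrCA mulrC.
Qed.

Let quot_bound K e : 0 < e -> (forall z, nrm (z : R[i]) = 1 -> nrm (S z : R[i]) <= K) ->
  exists J : {fset I}, forall A : {fset I}, J `<=` A ->
  (forall z, nrm (z : R[i]) = 1 -> nrm ((quot A).[z] : R[i]) <= K + e) /\
  (forall z, nrm (z : R[i]) <= 1 -> nrm (S z - z * (quot A).[z]) <= e).
Proof.
move=> e0 SK; have [J JP] := approx e0; exists J => A JA; split=> z z1; last first.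
  by rewrite quotE; exact: JP.
rewrite -[leLHS]mul1r -z1 -nrmM quotE.
have -> : \sum_(i <- A) z ^+ d i * a i = S z - (S z - \sum_(i <- A) z ^+ d i * a i).
  by rewrite subKr.
apply: le_trans (nrm_add _ _) _; rewrite nrm_opp; apply: lerD; first exact: SK.
by apply: JP; rewrite ?z1.
Qed.

(** The quotient of a large partial sum by z is nearly bounded by K on the unit
    circle, where dividing by z costs nothing, hence in the disc. *)
Lemma schwarz_bound K : (forall z, nrm (z : R[i]) = 1 -> nrm (S z : R[i]) <= K) ->
  forall z, nrm (z : R[i]) <= 1 -> nrm (S z : R[i]) <= nrm (z : R[i]) * K.
Proof.
move=> SK z z1; apply/ler_addgt0Pr => e e0.
have e20 : 0 < e / 2 by rewrite divr_gt0.
have [J /(_ _ (fsubset_refl J))[h1 h2]] := quot_bound e20 SK.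
rewrite -(subrK (z * (quot J).[z]) (S z)).
apply: le_trans (nrm_add _ _) _.
have h3 := maximum_modulus h1 z1; have h4 := h2 _ z1.
have h5 : nrm (z : R[i]) * nrm ((quot J).[z] : R[i]) <= nrm (z : R[i]) * (K + e / 2).
  by rewrite ler_wpM2l// nrm_ge0.
have h6 : nrm (z : R[i]) * (e / 2) <= e / 2 by rewrite ler_piMl// ltW.
by rewrite nrmM; lra.
Qed.

Variable B1 : {fset I}.
Hypothesis B1P : forall i, (i \in B1) = (d i == 1%N).

(** The sum over degree 1 is the constant coefficient of the quotient by z of any
    partial sum that contains these terms. *)
Lemma linear_coef_bound K : (forall z, nrm (z : R[i]) = 1 -> nrm (S z : R[i]) <= K) ->
  nrm (\sum_(i <- B1) a i : R[i]) <= K.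
Proof.
move=> SK; apply/ler_addgt0Pr => e e0.
have [J /(_ _ (fsubsetUl J B1))[h _]] := quot_bound e0 SK.
have := coef_bound h 0; congr (nrm _ <= _).
rewrite /quot coef_sum (sum_fsetD _ (fsubsetUr J B1)) [X in _ + X]big1_fset ?addr0.
  apply: eq_fbigr => i; rewrite B1P => /eqP di _.
  by rewrite coefZ coefXn di mulr1.
move=> i; rewrite !inE B1P coefZ coefXn => /andP[di _] _.
by case E: (d i) di => [|[|m]]//= _; [rewrite a0// mul0r | rewrite mulr0].
Qed.

Lemma linear_coef_remainder : exists M : R, forall z, nrm (z : R[i]) <= 1 ->
  nrm (S z - z * \sum_(i <- B1) a i) <= nrm (z : R[i]) ^+ 2 * M.
Proof.
have [J JP] := summable_abs_tail cvg_a ltr01.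
pose M := \sum_(i <- J) nrm (a i : R[i]) + 1.
have Mle (A : {fset I}) : \sum_(i <- A) nrm (a i : R[i]) <= M.
  apply: le_trans (_ : \sum_(i <- J `|` A) nrm (a i : R[i]) <= _).
    rewrite (sum_fsetD _ (fsubsetUr J A)) lerDl.
    by apply: sumr_ge0 => i _; rewrite nrm_ge0.
  rewrite (sum_fsetD _ (fsubsetUl J A)) lerD2l; apply: JP.
  by apply/fdisjointP => i; rewrite inE => /andP[].
exists M => z z1; apply: (limit_bound (A := B1) (Sa z1)) => A BA.
have -> : z * \sum_(i <- B1) a i = \sum_(i <- B1) z ^+ d i * a i.
  rewrite mulr_sumr; apply: eq_fbigr => i; rewrite B1P => /eqP -> _.
  by rewrite expr1.
rewrite (sum_fsetD _ BA) addrC addKr; apply: le_trans (nrm_sum _ _ _) _.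
apply: le_trans (_ : \sum_(i <- A `\` B1) nrm (z : R[i]) ^+ 2 * nrm (a i : R[i]) <= _).
  rewrite big_seq_cond [leRHS]big_seq_cond; apply: ler_sum => i.
  rewrite inE B1P andbT => /andP[di _]; rewrite nrmM nrmX.
  case E: (d i) di => [|[|m]]//= _; first by rewrite a0// nrm0 !mulr0.
  rewrite ler_wpM2r ?nrm_ge0// -addn2 exprD ler_piMl ?sqr_ge0//.
  by rewrite exprn_ile1// nrm_ge0.
by rewrite -mulr_sumr ler_wpM2l ?sqr_ge0.
Qed.

End Schwarz.

Section BoundedMaps.
Variable R : realType.

Lemma partial_sum_map (V W : normedModType R[i]) (g : V -> W) (C : R)
    (I : choiceType) (a : I -> V) (l : V) :
  (forall u w, g (u + w) = g u + g w) -> (forall u, nrm (g u) <= C * nrm u) ->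
  partial_sum a @ totally --> l -> partial_sum (g \o a) @ totally --> g l.
Proof.
move=> gD gC /partial_sum_cvgP al; apply/partial_sum_cvgP => e e0.
have g0 : g 0 = 0 by apply: (addrI (g 0)); rewrite -gD !addr0.
have gB u w : g (u - w) = g u - g w.
  by apply: (addIr (g w)); rewrite -gD !subrK.
have gS (A : {fset I}) : g (\sum_(i <- A) a i) = \sum_(i <- A) g (a i).
  by elim/big_rec2: _ => [//|i u w _ <-]; rewrite gD.
have C0 : 0 < `|C| + 1 by rewrite ltr_wpDl.
have [J JP] := al (e / (`|C| + 1)) (divr_gt0 e0 C0).
exists J => A JA; rewrite -gS -gB; apply: le_lt_trans (gC _) _.
have := JP A JA; rewrite ltr_pdivlMr// mulrC; apply: le_lt_trans.
rewrite ler_wpM2r ?nrm_ge0//; apply: le_trans (ler_norm C) _.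
by rewrite lerDl.
Qed.

Lemma partial_sum_sum (V : normedModType R[i]) (I : choiceType) (L : Type) (r : seq L)
    (a : L -> I -> V) (s : L -> V) :
  (forall l, partial_sum (a l) @ totally --> s l) ->
  partial_sum (fun i => \sum_(l <- r) a l i) @ totally --> \sum_(l <- r) s l.
Proof.
move=> as_; elim: r => [|l r IH].
  apply/partial_sum_cvgP => e e0; exists fset0 => A _.
  by rewrite big_nil big1 ?subrr ?nrm0// => i _; rewrite big_nil.
rewrite big_cons; apply/partial_sum_cvgP => e e0.
have e20 : 0 < e / 2 by rewrite divr_gt0.
have [J JP] := iffLR (partial_sum_cvgP _ _) (as_ l) _ e20.
have [J' JP'] := iffLR (partial_sum_cvgP _ _) IH _ e20.
exists (J `|` J')%fset => A; rewrite fsubUset => /andP[JA JA'].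
have -> : \sum_(i <- A) \sum_(l0 <- l :: r) a l0 i =
    \sum_(i <- A) a l i + \sum_(i <- A) \sum_(l0 <- r) a l0 i.
  by rewrite -big_split; apply: eq_bigr => i _; rewrite big_cons.
rewrite opprD addrACA; apply: le_lt_trans (nrm_add _ _) _.
by rewrite [ltRHS]splitr; apply: ltrD; [exact: JP | exact: JP'].
Qed.

End BoundedMaps.

(** * Homogeneous parts of a free series *)

Section HomogeneousParts.
Variables (R : realType) (k : nat) (n : 'I_k -> nat).
Implicit Types (c : free_series R n) (H : hilbertType R).

Definition total_degree (p : {ffun 'I_k -> nat}) : nat := \sum_i p i.

Lemma multiword_op_scale H (X : optuple n H) (z : R[i]) (w : multiword n) :
  multiword_op (cscale z X) w = z ^+ (\sum_i size (w i)) *: multiword_op X w.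
Proof.
rewrite /multiword_op expr_sum.
elim: (index_enum _) => [|i r IH]; first by rewrite !big_nil scale1r.
rewrite !big_cons {}IH (_ : cscale z X i = fun j => z *: X i j)// word_op_scale.
by rewrite bop_scaleAl bop_scaleAr scalerA.
Qed.

Lemma homogeneous_part_scale c H (X : optuple n H) (z : R[i]) p :
  homogeneous_part c (cscale z X) p =
  z ^+ total_degree p *: homogeneous_part c X p.
Proof.
rewrite scaler_sumr; apply: eq_bigr => w _.
rewrite multiword_op_scale !scalerA mulrC; congr (_ ^+ _ * _ *: _).
by apply: eq_bigr => i _; rewrite size_tuple.
Qed.

Definition deg1 (i : 'I_k) : {ffun 'I_k -> nat} := [ffun i' => nat_of_bool (i' == i)].

Lemma deg1_inj : injective deg1.
Proof.
move=> i i' /ffunP/(_ i); rewrite !ffunE eqxx.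
by case: eqVneq.
Qed.

Lemma total_degree_eq1 p : (total_degree p == 1%N) = (p \in [fset deg1 i | i : 'I_k])%fset.
Proof.
apply/sum_nat_eq1/imfsetP => [[i [_ pi pz]]|[i _ ->]].
  exists i => //; apply/ffunP => i'; rewrite ffunE.
  by case: eqVneq => [->//|/pz]; apply.
exists i; rewrite ffunE eqxx; split=> // i' /negPf ii' _.
by rewrite ffunE ii'.
Qed.

Definition letter (i : 'I_k) (j : 'I_(n i)) : multiword n :=
  dfwith (fun i' => [::] : seq 'I_(n i')) i [:: j].

Lemma letter_in i (j : 'I_(n i)) : letter j i = [:: j].
Proof. exact: dfwithin. Qed.

Lemma letter_out i (j : 'I_(n i)) i' : i' != i -> letter j i' = [::].
Proof. by move=> ii'; rewrite /letter dfwithout// eq_sym. Qed.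

Lemma size_letter i (j : 'I_(n i)) i' : size (letter j i') == deg1 i i'.
Proof.
rewrite ffunE; case: (eqVneq i' i) => [->|ii']; first by rewrite letter_in.
by rewrite letter_out.
Qed.

Lemma multiword_op_letter H (X : optuple n H) i (j : 'I_(n i)) :
  multiword_op X (letter j) = X i j.
Proof.
rewrite /multiword_op (big_only1 i)//.
  by rewrite letter_in /word_op big_seq1.
by move=> i' ii' _; rewrite letter_out// /word_op big_nil.
Qed.

Definition letter_tuple i (j : 'I_(n i)) :
    {dffun forall i', (deg1 i i').-tuple 'I_(n i')} :=
  [ffun i' => Tuple (size_letter j i')].

Lemma letter_tupleE i (j : 'I_(n i)) i' : letter_tuple j i' = letter j i' :> seq _.
Proof. by rewrite /letter_tuple (ffunE (fun i' => Tuple (size_letter j i')) i'). Qed.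

(** A multiword of total degree 1 in the i-th block is determined by its only
    letter; [n i] is positive so that the inverse map has a default letter. *)
Lemma homogeneous_part_deg1 c H (X : optuple n H) i : (0 < n i)%N ->
  homogeneous_part c X (deg1 i) = \sum_(j < n i) c (letter j) *: X i j.
Proof.
move=> ni; pose j0 := Ordinal ni.
rewrite /homogeneous_part (reindex (@letter_tuple i))/=.
  apply: eq_bigr => j _; rewrite -multiword_op_letter.
  have -> : (fun i' => tval (letter_tuple j i')) = letter j.
    by apply/functional_extensionality_dep => i'; exact: letter_tupleE.
  by [].
pose h' (w : {dffun forall i', (deg1 i i').-tuple 'I_(n i')}) := head j0 (tval (w i)).
exists h' => [j _|w _]; rewrite /h'.
  by rewrite letter_tupleE letter_in.
apply/ffunP => i'; apply: val_inj; rewrite /= letter_tupleE.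
have : size (tval (w i')) = nat_of_bool (i' == i) by rewrite size_tuple ffunE.
case: (eqVneq i' i) => [ii'|ii' /size0nil ->]; last by rewrite letter_out.
by subst i'; rewrite letter_in; case: (tval (w i)) => [|j []].
Qed.

Definition linear_form c H (X : optuple n H) : bop H :=
  \sum_(i < k) \sum_(j < n i) c (letter j) *: X i j.

Lemma linear_form_scale c H (X : optuple n H) z :
  linear_form c (cscale z X) = z *: linear_form c X.
Proof.
rewrite scaler_sumr; apply: eq_bigr => i _; rewrite scaler_sumr.
by apply: eq_bigr => j _; rewrite !scalerA mulrC.
Qed.

Hypothesis n_gt0 : forall i, (0 < n i)%N.

Lemma sum_deg1 c H (X : optuple n H) :
  \sum_(p <- [fset deg1 i | i : 'I_k]%fset) homogeneous_part c X p = linear_form c X.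
Proof.
rewrite big_imfset /=; last by move=> i i' _ _; exact: deg1_inj.
by rewrite big_enum /=; apply: eq_bigr => i _; rewrite homogeneous_part_deg1.
Qed.

Definition linear_part c : free_series R n :=
  fun w => if (\sum_i size (w i))%N == 1%N then c w else 0.

Lemma homogeneous_linear_part c H (X : optuple n H) p :
  homogeneous_part (linear_part c) X p =
  if total_degree p == 1%N then homogeneous_part c X p else 0.
Proof.
have sz (w : {dffun forall i, (p i).-tuple 'I_(n i)}) :
    (\sum_i size (tval (w i)))%N = total_degree p.
  by apply: eq_bigr => i _; rewrite size_tuple.
rewrite /homogeneous_part /linear_part.
by case: eqP => p1; [apply: eq_bigr => w _ | apply: big1 => w _];
  rewrite sz; case: eqP => //; rewrite scale0r.
Qed.

Lemma linear_part_cvg c H (X : optuple n H) :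
  partial_sum (homogeneous_part (linear_part c) X) @ totally --> linear_form c X.
Proof.
apply/partial_sum_cvgP => e e0; exists [fset deg1 i | i : 'I_k]%fset => A DA.
rewrite -sum_deg1 (sum_fsetD _ DA) [X in _ - (_ + X)]big1_fset => [|p].
  rewrite addr0 [X in _ - X](eq_fbigr _ (G := homogeneous_part c X)).
    by rewrite subrr nrm0.
  by move=> p; rewrite -total_degree_eq1 homogeneous_linear_part => ->.
rewrite inE -total_degree_eq1 homogeneous_linear_part => /andP[/negPf -> _].
by [].
Qed.

Lemma free_eval_lim c H (X : optuple n H) (T : bop H) :
  partial_sum (homogeneous_part c X) @ totally --> T -> free_eval c X = T.
Proof. by move=> cT; apply: cvg_lim cT; exact: norm_hausdorff. Qed.

Lemma homogeneous_part0 c H (X : optuple n H) p : c (fun=> [::]) = 0 ->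
  total_degree p = 0%N -> homogeneous_part c X p = 0.
Proof.
move=> c0 /eqP; rewrite sum_nat_eq0 => /forallP p0.
apply: big1 => w _; have -> : (fun i => tval (w i)) = fun=> [::].
  apply/functional_extensionality_dep => i; apply: size0nil.
  by rewrite size_tuple; apply/eqP; have := p0 i.
by rewrite c0 scale0r.
Qed.

(** At the zero tuple only the part of degree 0 survives; the multiplicity in
    front of it is the number of empty multiwords, which is positive. *)
Lemma constant_coef_eq0 c H : (exists x : H, x != 0) ->
  free_eval c (fun i j => 0 : bop H) = 0 -> c (fun=> [::]) = 0.
Proof.
move=> [x x0] c0; pose O : optuple n H := fun i j => 0.
have O0 : O = cscale 0 O.
  apply/functional_extensionality_dep => i; apply/funext => j.
  by rewrite /cscale scale0r.
pose p0 : {ffun 'I_k -> nat} := [ffun=> 0%N].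
have tp0 p : total_degree p = 0%N -> p = p0.
  move=> /eqP; rewrite sum_nat_eq0 => /forallP h; apply/ffunP => i.
  by rewrite ffunE; apply/eqP; have := h i.
have : homogeneous_part c O p0 = 0.
  rewrite -c0; symmetry; apply: free_eval_lim.
  apply/partial_sum_cvgP => e e0; exists [fset p0]%fset => A pA.
  rewrite (sum_fsetD _ pA) big_seq_fset1 big1_fset ?addr0 ?subrr ?nrm0//.
  move=> p; rewrite !inE => /andP[pp0 _] _; rewrite -/O.
  have := homogeneous_part_scale c O 0 p; rewrite -O0 => ->.
  rewrite expr0n; case: eqP => [/tp0 pE|_]; last by rewrite scale0r.
  by rewrite pE eqxx in pp0.
have -> : homogeneous_part c O p0 =
    (c (fun=> [::]) *: (1 : bop H)) *+ #|{dffun forall i, (p0 i).-tuple 'I_(n i)}|.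
  rewrite -sumr_const; apply: eq_bigr => w _.
  have wE : (fun i => tval (w i)) = fun=> [::].
    apply/functional_extensionality_dep => i; apply: size0nil.
    by rewrite size_tuple ffunE.
  rewrite wE; congr (_ *: _); rewrite /multiword_op big1// => i _.
  by rewrite /word_op big_nil.
rewrite -scaler_nat => /(congr1 (fun T : bop H => T x)).
rewrite -[LHS]/(_ *: (_ *: x)) bop_zeroE => /eqP.
rewrite !scaler_eq0 (negPf x0) orbF.
rewrite pnatr_eq0 => /orP[|/eqP//]; rewrite -leqn0 leqNgt => /negP[].
have s0 i : size ([::] : seq 'I_(n i)) == p0 i by rewrite ffunE.
by apply/card_gt0P; exists [ffun i => Tuple (s0 i)].
Qed.

End HomogeneousParts.

(** * The Schwarz lemma on polydomains *)

Section RowNorm.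
Variables (R : realType) (H : hilbertType R) (m : nat).
Implicit Types (T : 'I_m -> bop H) (x : 'I_m -> H).

Lemma row_norm_ub T x : \sum_(l < m) nrm (x l) ^+ 2 <= 1 ->
  nrm (\sum_(l < m) T l (x l)) <= row_norm T.
Proof.
move=> x1; apply: ub_le_sup; last by exists x.
exists (\sum_(l < m) opnorm (T l)) => _ [y /= y1 <-].
apply: le_trans (nrm_sum _ _ _) _; apply: ler_sum => l _.
apply: opnorm_ub; rewrite -(@expr_le1 _ 2) ?nrm_ge0//.
by apply: le_trans y1; rewrite (bigD1 l)//= lerDl sumr_ge0// => i _; rewrite sqr_ge0.
Qed.

Lemma row_norm_le T (M : R) :
  (forall x, \sum_(l < m) nrm (x l) ^+ 2 <= 1 -> nrm (\sum_(l < m) T l (x l)) <= M) ->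
  row_norm T <= M.
Proof.
move=> TM; apply: ge_sup; last by move=> _ [x x1 <-]; exact: TM.
exists (nrm (\sum_(l < m) T l 0)), (fun=> 0) => //=.
by rewrite big1 ?ler01// => l _; rewrite nrm0 expr0n.
Qed.

End RowNorm.

Section FreeHolomorphic.
Variables (R : realType) (k : nat) (n : 'I_k -> nat).
Variable q : forall i : 'I_k, ncpoly R (n i).
Hypotheses (n_gt0 : forall i, (0 < n i)%N) (qreg : forall i, positive_regular (q i)).

(** Only r <= 1 have to be considered, because the infimum is less than 1. *)
Lemma le_minkowski (H : hilbertType R) (X : optuple n H) (v : R) :
  polydomain q X ->
  (forall (r : R) (Y : optuple n H), 0 < r -> r <= 1 -> polydomain q Y ->
     X = cscale r%:C Y -> v <= r) -> v <= minkowski q X.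
Proof.
move=> XD Xv; have m1 := minkowski_lt1 qreg XD.
apply/ler_addgt0Pr => e e0.
have hinf : has_inf [set r : R | 0 < r /\ scaled_polydomain q r X].
  split; last by exists 0 => r [/ltW].
  by exists 1; split=> //; exists X => //; exact: cscale1.
have d0 : 0 < Num.min e (1 - minkowski q X) by rewrite lt_min e0 subr_gt0.
have [r [r0 [Y YD YX]] rm] := inf_adherent d0 hinf.
have re : r < minkowski q X + e by apply: lt_le_trans rm _; rewrite lerD2l ge_min lexx.
have r1 : r < 1.
  apply: lt_le_trans rm _; rewrite -/(minkowski q X) -lerBrDl.
  by rewrite ge_min lexx orbT.
by apply: le_trans (ltW re); apply: (Xv r Y) => //; exact: ltW.
Qed.

Lemma free_eval_cvg (c : free_series R n) (H : hilbertType R) (X : optuple n H) :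
  free_holomorphic q c -> polydomain q X ->
  partial_sum (homogeneous_part c X) @ totally --> free_eval c X.
Proof. by move=> ch XD; exact: ch. Qed.

Section Row.
Variables (H : hilbertType R) (m : nat) (F : 'I_m -> free_series R n).
Hypotheses (Fhol : forall l, free_holomorphic q (F l)).
Hypothesis (F1 : (sup_norm q F <= 1)%E).
Hypothesis (F0 : forall l, F l (fun=> [::]) = 0).
Variables (Y : optuple n H) (x : 'I_m -> H) (v : H).
Hypotheses (YD : polydomain q Y) (x1 : \sum_(l < m) nrm (x l) ^+ 2 <= 1).

(** Pairing with a vector v that will be the value to estimate. *)
Let a p := inner (\sum_(l < m) homogeneous_part (F l) Y p (x l)) v.
Let S z := inner (\sum_(l < m) free_eval (F l) (cscale z Y) (x l)) v.

Let a_eq0 p : total_degree p = 0%N -> a p = 0.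
Proof.
move=> p0; rewrite /a big1 ?linear0l// => l _.
by rewrite homogeneous_part0// bop_zeroE.
Qed.

Let S_cvg z : nrm (z : R[i]) <= 1 ->
  partial_sum (fun p => z ^+ total_degree p * a p) @ totally --> S z.
Proof.
move=> z1; have ZD : polydomain q (cscale z Y).
  by apply: polydomain_cscale => //; rewrite nrmE lecR.
pose g (u : H) := inner u v : R[i].
have -> : (fun p => z ^+ total_degree p * a p) =
    g \o (fun p => \sum_(l < m) homogeneous_part (F l) (cscale z Y) p (x l)).
  apply/funext => p; rewrite [RHS]/g /=.
  have -> : \sum_(l < m) homogeneous_part (F l) (cscale z Y) p (x l) =
      z ^+ total_degree p *: \sum_(l < m) homogeneous_part (F l) Y p (x l).
    by rewrite scaler_sumr; apply: eq_bigr => l _; rewrite homogeneous_part_scale.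
  by rewrite innerZl.
apply: (@partial_sum_map R H R[i] g (nrm v)).
- by move=> u w; exact: innerDl.
- by move=> u; rewrite mulrC; exact: nrm_inner.
apply: partial_sum_sum => l.
have gD (T T' : bop H) : (T + T') (x l) = T (x l) + T' (x l) by [].
have gC (T : bop H) : nrm (T (x l)) <= nrm (x l) * nrm T.
  by rewrite mulrC; exact: opnormP.
exact: (partial_sum_map gD gC (free_eval_cvg (@Fhol l) ZD)).
Qed.

Let S_bound z : nrm (z : R[i]) = 1 -> nrm (S z : R[i]) <= nrm v.
Proof.
move=> z1; apply: le_trans (nrm_inner _ _) _; rewrite ler_piMl ?nrm_ge0//.
apply: le_trans (row_norm_ub _ x1) _.
rewrite -lee_fin; apply: le_trans F1; apply: ereal_sup_ubound.
exists H, (cscale z Y); split=> //.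
by apply: polydomain_cscale => //; rewrite nrmE lecR z1.
Qed.

Lemma row_schwarz (r : R) : 0 < r -> r <= 1 ->
  v = \sum_(l < m) free_eval (F l) (cscale r%:C Y) (x l) -> nrm v <= r.
Proof.
move=> r0 r1 vE.
have rr : nrm (r%:C : R[i]) = r by rewrite nrm_real gtr0_norm.
have := @schwarz_bound R _ (@total_degree k) a S a_eq0 S_cvg (nrm v) S_bound r%:C.
rewrite rr => /(_ r1); rewrite /S -vE -norm_inner nrmE -rmorphXn nrm_real.
rewrite ger0_norm ?sqr_ge0//.
have [->|v0] := eqVneq (nrm v) 0; first by move=> _; exact: ltW.
by rewrite expr2 ler_pM2r// lt_neqAle eq_sym v0 nrm_ge0.
Qed.

Lemma row_linear : v = \sum_(l < m) linear_form (F l) Y (x l) -> nrm v <= 1.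
Proof.
move=> vE.
have := @linear_coef_bound R _ (@total_degree k) a S a_eq0 S_cvg
  [fset deg1 i | i : 'I_k]%fset (fun p => esym (total_degree_eq1 p)) (nrm v) S_bound.
have vE' : \sum_(p <- [fset deg1 i | i : 'I_k]%fset)
    \sum_(l < m) homogeneous_part (F l) Y p (x l) = v.
  rewrite exchange_big vE; apply: eq_bigr => l _.
  by rewrite -sum_deg1// bop_sumE.
rewrite /a -inner_suml vE'.
rewrite -norm_inner nrmE -rmorphXn nrm_real ger0_norm ?sqr_ge0//.
have [->|v0] := eqVneq (nrm v) 0; first by move=> _; exact: ler01.
by rewrite expr2 ger_pMl// lt_neqAle eq_sym v0 nrm_ge0.
Qed.

End Row.

(** Near 0 the scalar function along the j-th coordinate of the i-th block is an
    unordered power series on a multiple t of the coordinate tuple E that lies in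
    the scalar polydomain; its first coefficient is t times that of the letter. *)
Lemma partial_derivative_letter (c : free_series R n) i (j : 'I_(n i)) :
  free_holomorphic q c -> c (fun=> [::]) = 0 ->
  partial_derivative (scalar_representation c) j (fun _ _ => 0) = c (letter j).
Proof.
move=> ch c0.
pose E : optuple n (R[i] : hilbertType R) := fun i' j' =>
  dfwith (fun i' (_ : 'I_(n i')) => 0 : R[i]) i
    (dfwith (fun=> 0 : R[i]) j 1) i' j' *: (1 : bop R[i]).
have EE : cross_commuting E.
  by move=> s t st j1 j2; rewrite /E !bop_scaleAl !bop_scaleAr !mulr1 scalerA mulrC -scalerA.
have [t t0 YD] := small_polydomain qreg EE.
set Y := cscale t%:C E in YD.
have Eh (h : R[i]) : (fun i' j' => dfwith (fun i' (_ : 'I_(n i')) => 0 : R[i]) i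
     (dfwith (fun=> 0 : R[i]) j h) i' j' *: (1 : bop R[i])) = cscale h E.
  apply/functional_extensionality_dep => i'; apply/funext => j'.
  rewrite /cscale /E scalerA; congr (_ *: _).
  case: (eqVneq i i') => [ii'|ii']; last by rewrite !dfwithout// mulr0.
  subst i'; rewrite !dfwithin; case: (eqVneq j j') => [<-|jj'].
    by rewrite !dfwithin mulr1.
  by rewrite !dfwithout// mulr0.
pose G (h : R[i]) : R[i] := free_eval c (cscale h E) 1.
pose S (z : R[i]) : R[i] := free_eval c (cscale z Y) 1.
pose a p : R[i] := homogeneous_part c Y p 1.
have a0 p : total_degree p = 0%N -> a p = 0.
  by move=> p0; rewrite /a homogeneous_part0.
have Sa z : nrm (z : R[i]) <= 1 ->
    partial_sum (fun p => z ^+ total_degree p * a p) @ totally --> S z.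
  move=> z1; have ZD : polydomain q (cscale z Y).
    by apply: polydomain_cscale => //; rewrite nrmE lecR.
  have gD (T T' : bop R[i]) : (T + T') 1 = T 1 + T' 1 by [].
  have gC (T : bop R[i]) : nrm (T 1) <= nrm (1 : R[i]) * nrm T.
    by rewrite mulrC; exact: opnormP.
  have := partial_sum_map gD gC (free_eval_cvg ch ZD).
  have -> // : (fun T : bop R[i] => T 1) \o homogeneous_part c (cscale z Y) =
    fun p => z ^+ total_degree p * a p.
  by apply/funext => p; rewrite /= homogeneous_part_scale.
have linE : linear_form c E = c (letter j) *: (1 : bop R[i]).
  rewrite /linear_form (bigD1 i)//= [X in _ + X]big1 ?addr0; last first.
    move=> i' ii'; apply: big1 => j' _.
    by rewrite /E dfwithout 1?eq_sym// scale0r scaler0.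
  rewrite (bigD1 j)//= [X in _ + X]big1 ?addr0; last first.
    by move=> j' jj'; rewrite /E dfwithin dfwithout 1?eq_sym// scale0r scaler0.
  by rewrite /E !dfwithin scale1r.
have [M MP] := linear_coef_remainder a0 Sa (fun p => esym (total_degree_eq1 p)).
have aE : \sum_(p <- [fset deg1 i | i : 'I_k]%fset) a p = t%:C * c (letter j).
  rewrite -bop_sumE sum_deg1// linear_form_scale linE scalerA.
  by rewrite -[LHS]/(t%:C * c (letter j) * 1) mulr1.
rewrite aE in MP.
have tC0 : t%:C != 0 :> R[i] by rewrite gt_eqF// ltcR.
have GS h : G h = S (h / t%:C) by rewrite /G /S /Y cscale_comp divfK.
have G0 : G 0 = 0.
  have := MP 0; rewrite nrm0 ler01 => /(_ isT).
  rewrite mul0r subr0 expr0n mul0r => h; rewrite GS mul0r.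
  apply/eqP; rewrite -normr_eq0 nrmE; apply/eqP; congr _%:C; apply/eqP.
  by rewrite eq_le h nrm_ge0.
rewrite /partial_derivative.
have -> : (fun h : R[i] => scalar_representation c
    (dfwith (fun i' (_ : 'I_(n i')) => 0 : R[i]) i (dfwith (fun=> 0 : R[i]) j h))) = G.
  by apply/funext => h; rewrite /scalar_representation Eh.
rewrite /derive1; apply: cvg_lim; first exact: norm_hausdorff.
apply/cvg_nrmP => e e0.
have M0 : 0 < `|M| + 1 by rewrite ltr_wpDl.
have r0 : 0 < Num.min t (e * t ^+ 2 / (`|M| + 1)).
  by rewrite lt_min t0 divr_gt0// mulr_gt0// exprn_gt0.
have rC0 : (0 : R[i]) < (Num.min t (e * t ^+ 2 / (`|M| + 1)))%:C by rewrite ltcR.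
rewrite near_map; near=> h.
have h0 : h != 0 by near: h; exact: nbhs_dnbhs_neq.
have : `|h| < (Num.min t (e * t ^+ 2 / (`|M| + 1)))%:C by near: h; exact: dnbhs0_lt.
rewrite nrmE ltcR lt_min => /andP[ht he].
rewrite addr0 G0 subr0 GS.
have nt : nrm (t%:C^-1 : R[i]) = t^-1.
  by rewrite -fmorphV nrm_real ger0_norm// invr_ge0 ltW.
have nh0 : 0 < nrm (h : R[i]) by rewrite -ltcR -nrmE normr_gt0.
have ht1 : nrm (h / t%:C : R[i]) <= 1.
  by rewrite nrmM nt ler_pdivrMr// mul1r ltW.
have := MP _ ht1; rewrite mulrA divfK// nrmM nt.
set u := S _ => hM.
have -> : c (letter j) - h^-1 *: u = - (h^-1 *: (u - h * c (letter j))).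
  by rewrite scalerBr opprB -[h * _]/(h *: _) scalerA mulVf// scale1r.
rewrite nrm_opp nrmZ.
have nhV : nrm (h^-1 : R[i]) = (nrm (h : R[i]))^-1.
  apply: (mulfI (lt0r_neq0 nh0)); rewrite -nrmM (divff h0) (divff (lt0r_neq0 nh0)).
  by have := @nrm_real R 1; rewrite normr1.
rewrite nhV ltr_pdivrMl//; apply: le_lt_trans hM _.
apply: le_lt_trans (_ : nrm (h : R[i]) * (nrm (h : R[i]) * (`|M| + 1) / t ^+ 2) < _).
  have -> : nrm (h : R[i]) * (nrm (h : R[i]) * (`|M| + 1) / t ^+ 2) =
      (nrm (h : R[i]) / t) ^+ 2 * (`|M| + 1) by field; rewrite gt_eqF.
  rewrite ler_wpM2l ?sqr_ge0//; apply: le_trans (ler_norm M) _.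
  by rewrite lerDl.
by rewrite ltr_pM2l// ltr_pdivrMr ?exprn_gt0// -ltr_pdivlMr.
Unshelve. all: by end_near. Qed.

End FreeHolomorphic.

Lemma infinite_dimensional_neq0 (R : realType) (H : hilbertType R) :
  infinite_dimensional H -> exists x : H, x != 0.
Proof.
move=> infH; apply: contrapT => nx; apply: infH.
exists 0%N, (fun=> 0) => x; exists (fun=> 0); rewrite big_ord0.
by apply/eqP; apply: contrapT => x0; apply: nx; exists x; apply/negP.
Qed.

Section SchwarzLemma.
Variables (R : realType) (k : nat) (n : 'I_k -> nat).
Variable q : forall i : 'I_k, ncpoly R (n i).
Hypotheses (n_gt0 : forall i, (0 < n i)%N) (qreg : forall i, positive_regular (q i)).
Variables (H : hilbertType R) (m : nat) (F : 'I_m -> free_series R n).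
Hypotheses (Fhol : forall l, free_holomorphic q (F l)).
Hypothesis (F1 : (sup_norm q F <= 1)%E).
Hypothesis (F0 : forall l, F l (fun=> [::]) = 0).

Lemma schwarz_row_norm (X : optuple n H) : polydomain q X ->
  row_norm (fun l => free_eval (F l) X) <= minkowski q X.
Proof.
move=> XD; apply: le_minkowski => // r Y r0 r1 YD XE.
by apply: row_norm_le => x x1; rewrite XE; exact: (row_schwarz qreg Fhol F1 F0 YD x1).
Qed.

Lemma opnorm_linear_form l (X : optuple n H) : polydomain q X ->
  opnorm (linear_form (F l) X) <= minkowski q X.
Proof.
move=> XD; apply: le_minkowski => // r Y r0 r1 YD ->.
rewrite linear_form_scale opnormZ nrm_real gtr0_norm// ler_piMr ?(ltW r0)//.
apply: opnorm_le => x x1.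
pose y l' := if l' == l then x else 0.
have y1 : \sum_(l' < m) nrm (y l') ^+ 2 <= 1.
  rewrite (bigD1 l)//= [X in _ + X]big1 ?addr0.
    by rewrite /y eqxx expr_le1// nrm_ge0.
  by move=> l' /negPf ll'; rewrite /y ll' nrm0 expr0n.
apply: (row_linear n_gt0 qreg Fhol F1 F0 YD y1).
rewrite (bigD1 l)//= [X in _ + X]big1 ?addr0; first by rewrite /y eqxx.
by move=> l' /negPf ll'; rewrite /y ll' linear0.
Qed.

End SchwarzLemma.

Theorem theorem3p4 (R : realType) (k : nat) (n : 'I_k -> nat)
    (q : forall i : 'I_k, ncpoly R (n i)) (H : hilbertType R)
    (p : nat) (F : 'I_p -> free_series R n) :
  (0 < k)%N -> (forall i, 0 < n i)%N -> (forall i, positive_regular (q i)) ->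
  separable H -> infinite_dimensional H -> (0 < p)%N ->
  (forall l, free_holomorphic q (F l)) ->
  (sup_norm q F <= 1)%E ->
  (forall l, free_eval (F l) (fun i j => 0 : bop H) = 0) ->
  (forall X : optuple n H, polydomain q X ->
     row_norm (fun l => free_eval (F l) X) <= minkowski q X /\
     minkowski q X < 1) /\
  (forall l : 'I_p, p = 1%N ->
     exists2 psi : free_series R n, free_holomorphic q psi &
       forall X : optuple n H, polydomain q X ->
         [/\ free_eval psi X =
               \sum_(i < k) \sum_(j < n i)
                 partial_derivative (scalar_representation (F l)) j
                   (fun _ _ => 0) *: X i j,
             `|free_eval psi X| <= (minkowski q X)%:C
           & minkowski q X < 1]).
Proof.
move=> _ n_gt0 qreg _ infH _ Fhol F1 Fz.
have F0 l : F l (fun=> [::]) = 0.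
  exact: constant_coef_eq0 (infinite_dimensional_neq0 infH) (Fz l).
split=> [X XD|l _].
  by split; [exact: schwarz_row_norm | exact: minkowski_lt1].
exists (linear_part (F l)) => [L X XD|X XD].
  by apply/cvg_ex; exists (linear_form (F l) X); exact: linear_part_cvg.
rewrite (free_eval_lim (linear_part_cvg n_gt0 (c := F l) (X := X))).
split; last exact: minkowski_lt1.
- rewrite /linear_form; apply: eq_bigr => i _; apply: eq_bigr => j _.
  by rewrite (partial_derivative_letter n_gt0 qreg).
- by rewrite nrmE lecR; exact: (opnorm_linear_form n_gt0 qreg Fhol F1 F0 l XD).
Qed.
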